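(* Let $N\ge1$ and $p\ge1$ be integers, and let $V:\mathbb{R}_+\to\mathbb{R}\cup\{\infty\}$ be a measurable function for which the beta ensemble with $\beta=2p$ and radial potential $V$ is well defined (i.e. its density has finite positive total mass). Let $(\lambda_1,\dots,\lambda_N)$ be distributed according to this ensemble. Then the squared radii are conditionally independent given the latent variable $I$: conditioning on the event $\{I=\mathbf{u}\}$, $\mathbf{u}=(u_1,\dots,u_N)$, $$\{|\lambda_1|^2,\dots,|\lambda_N|^2\}\stackrel{d}{=}\{X_1,\dots,X_N\},$$ where $X_1,\dots,X_N$ are independent and $X_i$ has the $\Gamma_V$ distribution with parameter $1+u_i$. That is, the law of the (unordered) set $\{|\lambda_1|^2,\dots,|\lambda_N|^2\}$ is the law of the set $\{X_1,\dots,X_N\}$ obtained by first sampling $I$ and then, given $I=\mathbf{u}$, sampling independent $X_i$ with $\Gamma_V$ distribution of parameter $1+u_i$.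
   Context: The beta ensemble with parameter $\beta$ and radial potential $V$ is the law of $N$ complex random points with joint density $\frac{1}{\pi^NZ_{\beta,N}}\prod_{i<j}|z_i-z_j|^\beta\prod_{i=1}^Ne^{-V(|z_i|^2)}$ with respect to Lebesgue measure on $\mathbb{C}^N$, with $Z_{\beta,N}$ the normalizing constant. $\Gamma_V(\alpha)=\int_0^\infty t^{\alpha-1}e^{-V(t)}\,\mathrm{d}t$; when this is finite, the $\Gamma_V$ distribution of parameter $\alpha$ is the probability law on $\mathbb{R}_+$ with density $\frac{1}{\Gamma_V(\alpha)}t^{\alpha-1}e^{-V(t)}$. For $\mathbf{u}\in\mathbb{Z}^N$, $K_{N,p}(\mathbf{u})$ is the coefficient of $T_1^{u_1}\cdots T_N^{u_N}$ in the $p$-th power $\Delta(T_1,\dots,T_N)^p$ of the Vandermonde determinant in $N$ variables. The latent variable $I$ takes values in $\mathbb{Z}^N$ with distribution $$\mathbb{P}(I=\mathbf{u})=\frac{1}{Z_{2p,N}}K_{N,p}(\mathbf{u})^2\prod_{i=1}^N\Gamma_V(1+u_i)$$ (understood as $0$ when $K_{N,p}(\mathbf{u})=0$); that these weights sum to $1$ is part of the result. *)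

(* Defs.v *)
From HB Require Import structures.
From mathcomp Require Import all_boot all_order all_algebra.
From mathcomp Require Import -(notations) mpoly.
From mathcomp Require Import finmap multiset complex.
From mathcomp Require Import all_classical all_reals all_analysis.
From mathcomp Require Import measurable_realfun.

Set Implicit Arguments.
Unset Strict Implicit.
Unset Printing Implicit Defensive.

Import Order.TTheory GRing.Theory Num.Theory.
Import numFieldNormedType.Exports.

Local Open Scope classical_set_scope.
Local Open Scope ring_scope.

(* The library registers no sigma-finite structure on mu \x nu outside of the
   subprobability case, hence this lemma. *)
Lemma sigma_finite_product d1 d2 (T1 : measurableType d1)
    (T2 : measurableType d2) (R : realType)
    (mu : {sigma_finite_measure set T1 -> \bar R})
    (nu : {sigma_finite_measure set T2 -> \bar R}) :
  sigma_finite setT (mu \x nu)%E.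
Proof.
have /sigma_finiteP[F [TF ndF Foo]] := sigma_finiteT mu.
have /sigma_finiteP[G [TG ndG Goo]] := sigma_finiteT nu.
exists (fun n => F n `*` G n).
  rewrite -setXTT TF TG predeqE => -[x y]; split.
    move=> [/= [n _ Fnx] [k _ Gky]]; exists (maxn n k) => //; split.
    - by move: x Fnx; exact/subsetPset/ndF/leq_maxl.
    - by move: y Gky; exact/subsetPset/ndG/leq_maxr.
  by move=> [n _ []/= ? ?]; split; exists n.
move=> k; have [? ?] := Foo k; have [? ?] := Goo k.
split; first exact: measurableX.
by rewrite product_measure1E// lte_mul_pinfty// ge0_fin_numE.
Qed.

(* The n-th power of a sigma-finite measure on T, as a measure on n.-tuple T:
   transport of the product of mu and its (n-1)-st power along consing. *)
Section power_measure.
Context d (T : measurableType d) (R : realType).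
Variable mu : {sigma_finite_measure set T -> \bar R}.
Local Open Scope ereal_scope.

Definition cons_pair n (x : T * n.-tuple T) : n.+1.-tuple T :=
  [tuple of x.1 :: x.2].

Lemma measurable_cons_pair n : measurable_fun setT (@cons_pair n).
Proof. exact: measurable_cons. Qed.

HB.instance Definition _ n :=
  isMeasurableFun.Build _ _ _ _ (@cons_pair n) (@measurable_cons_pair n).

Section cons_measure.
Variables (n : nat) (nu : {sigma_finite_measure set (n.-tuple T) -> \bar R}).

Definition cons_measure : set (n.+1.-tuple T) -> \bar R :=
  pushforward (mu \x nu) (@cons_pair n).

Let cons_measure0 : cons_measure set0 = 0.
Proof. exact: measure0. Qed.

Let cons_measure_ge0 A : 0 <= cons_measure A.
Proof. exact: measure_ge0. Qed.

Let cons_measure_sigma_additive : semi_sigma_additive cons_measure.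
Proof. exact: measure_semi_sigma_additive. Qed.

HB.instance Definition _ := isMeasure.Build _ _ _ cons_measure
  cons_measure0 cons_measure_ge0 cons_measure_sigma_additive.

Let cons_measure_sigma_finite : sigma_finite setT cons_measure.
Proof.
pose uncons (t : n.+1.-tuple T) : T * n.-tuple T :=
  (thead t, [tuple of behead t]).
have consK : cancel (@cons_pair n) uncons.
  by move=> [x t]; rewrite /uncons theadE; congr (_, _); exact/val_inj.
have muncons : measurable_fun setT uncons.
  by apply: measurable_fun_pair;
    [exact: measurable_tnth|exact: measurable_behead].
have [F TF mF] := sigma_finite_product mu nu.
exists (fun k => uncons @^-1` F k).
  by rewrite -preimage_bigcup -TF preimage_setT.
move=> k; have [mFk Fkoo] := mF k; split.
  by rewrite -[X in measurable X]setTI; exact: muncons.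
by rewrite /cons_measure /pushforward -comp_preimage (funext consK : _ \o _ = id).
Qed.

HB.instance Definition _ :=
  Measure_isSigmaFinite.Build _ _ _ cons_measure cons_measure_sigma_finite.

End cons_measure.

Fixpoint power_measure n : {sigma_finite_measure set (n.-tuple T) -> \bar R} :=
  match n with
  | 0%N => \d_[tuple]
  | m.+1 => cons_measure (power_measure m)
  end.

End power_measure.

Section plane.
Variable R : realType.

(* The complex plane, as a measurable space, is R * R; [cplx] is the
   identification with the field R[i]. *)
Definition plane := (measurableTypeR R * measurableTypeR R)%type.

Definition cplx (z : plane) : R[i] := (z.1 +i* z.2)%C.

Definition cmod (z : R[i]) : R := ComplexField.Normc.normc z.

Definition lebesgue_plane : set plane -> \bar R :=
  (lebesgue_measure \x lebesgue_measure)%E.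

Let lebesgue_plane0 : lebesgue_plane set0 = 0%E.
Proof. exact: measure0. Qed.

Let lebesgue_plane_ge0 A : (0 <= lebesgue_plane A)%E.
Proof. exact: measure_ge0. Qed.

Let lebesgue_plane_sigma_additive : semi_sigma_additive lebesgue_plane.
Proof. exact: measure_semi_sigma_additive. Qed.

HB.instance Definition _ := isMeasure.Build _ _ _ lebesgue_plane
  lebesgue_plane0 lebesgue_plane_ge0 lebesgue_plane_sigma_additive.

HB.instance Definition _ := Measure_isSigmaFinite.Build _ _ _ lebesgue_plane
  (sigma_finite_product lebesgue_measure lebesgue_measure).

End plane.

Section ensemble.
Variable R : realType.

Definition lebesgue_CN (N : nat) := power_measure (@lebesgue_plane R) N.

Variables (N : nat) (beta : R) (V : R -> \bar R).

Definition beta_weight (z : N.-tuple (plane R)) : \bar R :=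
  ((\prod_(ij : 'I_N * 'I_N | (ij.1 < ij.2)%N)
      cmod (cplx (tnth z ij.1) - cplx (tnth z ij.2)) `^ beta)%:E
   * \prod_(i < N) expeR (- V (cmod (cplx (tnth z i)) ^+ 2)))%E.

Definition beta_mass : \bar R := (\int[lebesgue_CN N]_z beta_weight z)%E.

Definition beta_well_defined := (0 < beta_mass < +oo)%E.

(* The constant Z_{beta,N} making beta_weight / (pi^N Z_{beta,N}) a density. *)
Definition beta_Z : R := fine beta_mass / pi ^+ N.

Definition is_beta_ensemble d (Omega : measurableType d)
    (P : probability Omega R) (lambda : {RV P >-> N.-tuple (plane R)}) :=
  forall A, measurable A ->
    (distribution P lambda A =
     \int[lebesgue_CN N]_(z in A) (((pi ^+ N * beta_Z)^-1)%:E * beta_weight z))%E.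

End ensemble.

Definition halfline (R : realType) : set R := `[0, +oo[.
Arguments halfline : clear implicits.

Section gammaV.
Variables (R : realType) (V : R -> \bar R).

Definition gammaV_weight (alpha t : R) : \bar R :=
  ((t `^ (alpha - 1))%:E * expeR (- V t))%E.

Definition GammaV (alpha : R) : \bar R :=
  (\int[lebesgue_measure]_(t in halfline R) gammaV_weight alpha t)%E.

(* Random variables are considered under an arbitrary set function Q so that
   the notions apply both to a probability and to a conditional probability. *)
Definition has_GammaV_law d (Omega : measurableType d) (Q : set Omega -> \bar R)
    (X : Omega -> R) (alpha : R) :=
  (0 < GammaV alpha < +oo)%E /\
  forall B : set (measurableTypeR R), measurable B ->
    (Q (X @^-1` B) =
     \int[lebesgue_measure]_(t in B `&` halfline R)
        (((fine (GammaV alpha))^-1)%:E * gammaV_weight alpha t))%E.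

End gammaV.

Definition cond_prob (R : realType) d (Omega : measurableType d)
    (P : set Omega -> \bar R) (E A : set Omega) : \bar R :=
  (((fine (P E))^-1)%:E * P (A `&` E))%E.

Definition mutually_independent (R : realType) d (Omega : measurableType d)
    (Q : set Omega -> \bar R) N (X : 'I_N -> Omega -> R) :=
  forall (J : {set 'I_N}) (B : 'I_N -> set (measurableTypeR R)),
    (forall i, measurable (B i)) ->
    (Q (\bigcap_(i in [set` J]) X i @^-1` B i) =
     \prod_(i in J) Q (X i @^-1` B i))%E.

Section latent.
Variables (N p : nat).

Definition vandermonde_poly : mpoly.mpoly N int :=
  \det (Vandermonde N (\row_(j < N) mpoly.mpolyX int (mpoly.mnm1 j))).

(* Exponents are integers: K_{N,p}(u) = 0 as soon as some u_i is negative. *)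
Definition vandermonde_coef (u : N.-tuple int) : int :=
  if [forall i, 0 <= tnth u i] then
    mpoly.mcoeff (mpoly.Multinom [tuple `|tnth u i|%N | i < N])
      (vandermonde_poly ^+ p)
  else 0.

Variables (R : realType) (V : R -> \bar R).

Definition gamma_param (u : N.-tuple int) (i : 'I_N) : R :=
  1 + (tnth u i)%:~R.

Definition latent_weight (u : N.-tuple int) : \bar R :=
  if vandermonde_coef u == 0 then 0%E else
  (((vandermonde_coef u)%:~R ^+ 2 / beta_Z N (2 * p)%:R V)%:E
   * \prod_(i < N) GammaV V (gamma_param u i))%E.

Definition indep_GammaV d (Omega : measurableType d) (Q : set Omega -> \bar R)
    (X : 'I_N -> Omega -> R) (u : N.-tuple int) :=
  mutually_independent Q X /\
  forall i, has_GammaV_law V Q (X i) (gamma_param u i).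

Definition has_latent_law d (Omega : measurableType d)
    (P : probability Omega R) (I : Omega -> N.-tuple int) :=
  forall u, measurable (I @^-1` [set u]) /\
            P (I @^-1` [set u]) = latent_weight u.

(* First sample I, then, given I = u, independent X_i of parameters 1 + u_i. *)
Definition two_stage_sample d (Omega : measurableType d)
    (P : probability Omega R) (I : Omega -> N.-tuple int)
    (X : 'I_N -> {RV P >-> measurableTypeR R}) :=
  has_latent_law P I /\
  forall u, (0 < latent_weight u)%E ->
    indep_GammaV (cond_prob P (I @^-1` [set u])) X u.

End latent.

Section unordered.
Variable R : realType.

(* Unordered families of N reals are multisets, with the quotient
   sigma-algebra of the Borel sigma-algebra of R^N. *)
Definition unordered N (x : 'I_N -> R) : {mset R}%mset :=
  seq_mset [tuple x i | i < N].

Definition unordered_event N (A : set {mset R}%mset) :=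
  measurable [set x : N.-tuple (measurableTypeR R) | A (seq_mset x)].

Definition sqr_radii N (z : N.-tuple (plane R)) (i : 'I_N) : R :=
  cmod (cplx (tnth z i)) ^+ 2.

End unordered.

(* Main.v *)
From HB Require Import structures.
Require Import Defs.
From mathcomp Require Import all_boot all_order all_algebra.
From mathcomp Require Import cyclic separable cyclotomic.
From mathcomp Require Import -(notations) mpoly.
From mathcomp Require Import finmap multiset complex.
From mathcomp Require Import all_classical all_reals all_analysis.
From mathcomp Require Import measurable_realfun.
From mathcomp Require Import ring lra.

Set Implicit Arguments.
Unset Strict Implicit.
Unset Printing Implicit Defensive.

Import Order.TTheory GRing.Theory Num.Theory.
Import numFieldNormedType.Exports.
Local Open Scope classical_set_scope.
Local Open Scope ring_scope.

(** The weight is |Delta(z)|^(2p) times a function of the squared radii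
    t_i = |z_i|^2. Expanding Delta^p = sum_m K_m z^m and averaging over the
    arguments of the z_i kills the cross terms of |Delta^p|^2 and leaves
    D(t) = sum_m K_m^2 t^m. As t = |z|^2 pushes the Lebesgue measure of the plane
    to pi dt, the vector of squared radii has density proportional to
    sum_m K_m^2 prod_i t_i^(m_i) e^(-V(t_i)): a mixture of products of Gamma_V
    laws, with the latent weights. On the given space, the latent variable is
    sampled from its posterior law K_m^2 t^m / D(t).

    Instead of integrating over angles, we average over rotations by roots of
    unity of large order, so that no polar coordinates are needed. *)

(** * Parseval over roots of unity *)

(** The finite average is exact because Delta^p has finitely many exponents; it asks only that
    Lebesgue measure be invariant under rotations. Similarly, scaling alone determines the image of
    this measure under |z|^2 up to a constant. The hypothesis on the total mass yields all that is
    needed about Gamma_V. The mass is the sum of the nonnegative terms K_m^2 pi^N prod_i Gamma_V(1 +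
    m_i), so its finiteness passes to every term with K_m != 0. Its positivity makes some Gamma_V(1
    + k) positive, and for natural k these numbers vanish all together or not at all. The index is
    not a function of the points, so it has to live on a larger space. Its posterior weights depend
    on the squared radii only, hence the averaging also applies to events involving the index. They
    sum to 1 only where D(t) != 0, but the averaged density has the factor D(t), so the exceptional
    set is null. Every identity is proved for the ordered vector of squared radii; multisets enter
    only through preimages. *)

Lemma prim_root_exists (C : numClosedFieldType) n :
  (0 < n)%N -> exists w : C, n.-primitive_root w.
Proof.
move=> n0; have [r Dp] := closed_field_poly_normal ('X^n - 1 : {poly C}).
rewrite (monicP _) ?monicXnsubC// scale1r in Dp.
have rn1 : all n.-unity_root r by apply/allP => z; rewrite -root_prod_XsubC -Dp.
have sr : (n < (size r).+1)%N by rewrite -(size_prod_XsubC r id) -Dp size_XnsubC.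
have [|z _ nz] := hasP (has_prim_root n0 rn1 _ sr); last by exists z.
(* In characteristic 0 the polynomial X^n - 1 is separable, so its n roots are distinct; n distinct
   n-th roots of unity include a primitive one. *)
by rewrite -separable_prod_XsubC -Dp separable_Xn_sub_1// pnatr_eq0 -lt0n.
Qed.

Lemma norm_prim_root (C : numClosedFieldType) n (w : C) :
  n.-primitive_root w -> `|w| = 1.
Proof.
move=> nw; apply/eqP; rewrite -(@pexpr_eq1 _ _ n) ?(prim_order_gt0 nw)//.
by rewrite -normrX (prim_expr_order nw) normr1.
Qed.

(** The ratio x equals w^(a-b), so x^n = 1, and x != 1 when a and b are distinct and below n; the
    geometric sum times x - 1 is then x^n - 1 = 0. *)
Lemma sum_prim_root_conj (C : numClosedFieldType) n (w : C) (a b : nat) :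
  n.-primitive_root w -> (a < n)%N -> (b < n)%N ->
  \sum_(j < n) (w ^+ a * (w ^+ b)^*) ^+ j = (n * (a == b))%:R.
Proof.
move=> nw an bn; have w1 := norm_prim_root nw.
have [->|ab] := eqVneq a b.
  rewrite -normCK normrX w1 !expr1n muln1.
  by under eq_bigr do rewrite expr1n; rewrite sumr_const card_ord.
rewrite muln0; set x := w ^+ a * _.
have xn : x ^+ n = 1.
  by rewrite exprMn -rmorphXn -!exprM ![(_ * n)%N]mulnC !exprM
    (prim_expr_order nw) !expr1n rmorph1 mulr1.
have x1 : x - 1 != 0.
  rewrite subr_eq0; apply: contra_neq ab => x1; apply/eqP.
  have : w ^+ a = w ^+ b.
    rewrite -[RHS]mul1r -x1 /x -mulrA [X in _ * X]mulrC -normCK normrX w1.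
    by rewrite !expr1n mulr1.
  by move/eqP; rewrite (eq_prim_root_expr nw) !modn_small.
by apply/eqP; rewrite -(mulrI_eq0 _ (mulfI x1)) -subrX1 xn subrr.
Qed.

(* Averaging over rotations by roots of unity of order larger than every
   exponent replaces averaging over all angles: distinct monomials become
   orthogonal. *)
Lemma parseval_mpoly (C : numClosedFieldType) N M (w : C)
    (P : mpoly.mpoly N int) (z : 'I_N -> C) :
  M.-primitive_root w ->
  (forall m, m \in mpoly.msupp P -> forall i, (m i < M)%N) ->
  \sum_(k : {ffun 'I_N -> 'I_M})
     `|mpoly.mmap intr (fun i => w ^+ k i * z i) P| ^+ 2 =
  (M ^ N)%:R * \sum_(m <- mpoly.msupp P)
     (mpoly.mcoeff m P)%:~R ^+ 2 * \prod_i (`|z i| ^+ 2) ^+ m i.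
Proof.
move=> Mw degP.
have E k : `|mpoly.mmap intr (fun i => w ^+ k i * z i) P| ^+ 2 =
   \sum_(m <- mpoly.msupp P) \sum_(m' <- mpoly.msupp P)
     ((mpoly.mcoeff m P)%:~R * (mpoly.mcoeff m' P)%:~R *
      \prod_i (z i ^+ m i * (z i ^+ m' i)^*)) *
     \prod_i (w ^+ m i * (w ^+ m' i)^*) ^+ k i.
  rewrite normCK /mpoly.mmap rmorph_sum big_distrlr/=.
  apply: eq_bigr => m _; apply: eq_bigr => m' _.
  rewrite rmorphM rmorph_int /mpoly.mmap1 mulrACA -!mulrA; congr (_ * (_ * _)).
  rewrite rmorph_prod -!big_split/=; apply: eq_bigr => i _.
  rewrite !exprMn -!exprM rmorphM -!rmorphXn/= -!exprM mulrACA.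
  by rewrite [LHS]mulrC ![(k i * _)%N]mulnC.
(* The sum over all [k] of a product over coordinates is the product over coordinates of
   one-variable sums. *)
have S m m' : m \in mpoly.msupp P -> m' \in mpoly.msupp P ->
    \sum_(k : {ffun 'I_N -> 'I_M}) \prod_i (w ^+ m i * (w ^+ m' i)^*) ^+ k i =
    \prod_i (M * (m i == m' i))%:R.
  move=> mP m'P; pose F i (j : 'I_M) := (w ^+ m i * (w ^+ m' i)^*) ^+ j.
  rewrite -(bigA_distr_bigA F); apply: eq_bigr => i _.
  by apply: sum_prim_root_conj; [|exact: degP|exact: degP].
under eq_bigr do rewrite E; rewrite exchange_big mulr_sumr/=.
apply: eq_big_seq => m mP; rewrite exchange_big/=.
under eq_big_seq => m' m'P do rewrite -mulr_sumr S//.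
rewrite (bigD1_seq m)//= ?mpoly.msupp_uniq// [X in _ + X]big1_seq ?addr0.
  rewrite -expr2 [RHS]mulrC; congr (_ * _ * _).
    by apply: eq_bigr => i _; rewrite -normCK normrX exprAC.
  under eq_bigr do rewrite eqxx muln1.
  by rewrite prodr_const card_ord natrX.
(* Distinct exponent vectors differ at some coordinate [i], whose one-variable sum is 0. *)
move=> m' /andP[m'm m'P].
have /existsP[i mi] : [exists i, m i != m' i].
  apply: contra_neqT m'm; rewrite negb_exists => /forallP mm'.
  by apply/mpoly.mnmP => i; apply/esym/eqP; rewrite -[_ == _]negbK mm'.
rewrite (bigD1 (F := fun i => (M * (m i == m' i))%:R) i)//= (negbTE mi).
by rewrite muln0 mul0r mulr0.
Qed.

(** * Densities and rectangles *)

Section density_measure.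
Local Open Scope ereal_scope.
Context d (T : measurableType d) (R : realType).
Variables (mu : {measure set T -> \bar R}) (f : T -> \bar R).
Hypotheses (mf : measurable_fun setT f) (f0 : forall x, 0 <= f x).

(** The two proofs are arguments of the term so that the measure instance can be read off from
    it. *)
Definition density_measure of measurable_fun setT f & (forall x, 0 <= f x) :=
  fun A => \int[mu]_(x in A) f x.

Local Notation nu := (density_measure mf f0).

Let nu_set0 : nu set0 = 0. Proof. exact: integral_set0. Qed.

Let nu_ge0 A : 0 <= nu A. Proof. by apply: integral_ge0 => x _; exact: f0. Qed.

Let nu_sigma_additive : semi_sigma_additive nu.
Proof. exact: semi_sigma_additive_nng_induced. Qed.

HB.instance Definition _ :=
  isMeasure.Build _ _ _ nu nu_set0 nu_ge0 nu_sigma_additive.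

Import HBNNSimple.

(** True by definition for indicators, hence for simple functions, then for [g] by monotone
    convergence. Finiteness of [f] lets the limit pass through the product with [f x]. *)
Lemma ge0_integral_density_measure (g : T -> \bar R) :
  (forall x, f x \is a fin_num) -> measurable_fun setT g -> (forall x, 0 <= g x) ->
  \int[nu]_x g x = \int[mu]_x (g x * f x).
Proof.
move=> ffin mg g0; pose h := nnsfun_approx measurableT mg.
have mh n : measurable_fun setT (EFin \o h n) by exact/measurable_EFinP.
have gE x : g x = lim ((EFin \o h n) x @[n --> \oo]).
  by apply/esym/cvg_lim => //; apply: cvg_nnsfun_approx => // y _; exact: g0.
have gfE x : g x * f x = lim (((EFin \o h n) \* f) x @[n --> \oo]).
  apply/esym/cvg_lim => //; apply: cvgeZr; first exact: ffin.
  by apply: cvg_nnsfun_approx => // y _; exact: g0.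
transitivity (limn (fun n => \int[nu]_x (EFin \o h n) x)).
  rewrite -(@monotone_convergence _ _ _ nu)//.
  - by apply: eq_integral => x _; exact: gE.
  - by move=> n x _; rewrite lee_fin.
  - by move=> x _ a b ab; rewrite lee_fin; exact/lefP/nd_nnsfun_approx.
transitivity (limn (fun n => \int[mu]_x ((EFin \o h n) \* f) x)); last first.
  rewrite -monotone_convergence//.
  - by apply: eq_integral => x _; rewrite gfE.
  - by move=> n; apply: emeasurable_funM.
  - by move=> n x _; rewrite mule_ge0 ?lee_fin.
  - move=> x _ a b ab; rewrite lee_wpmul2r ?lee_fin//.
    exact/lefP/nd_nnsfun_approx.
congr (limn _); apply/funext => n.
have mk (k : R) : measurable_fun setT
    (fun x => (k * \1_(h n @^-1` [set k]) x)%:E).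
  by apply/measurable_EFinP; exact: measurable_funM.
under [LHS]eq_integral do rewrite /= fimfunE -fsumEFin//.
rewrite (@ge0_integral_fsum _ _ _ nu)//; last first.
  by move=> k x _; exact: nnfun_muleindic_ge0.
transitivity (\int[mu]_x (\sum_(y \in range (h n))
    (y * \1_(h n @^-1` [set y]) x)%:E * f x)); last first.
  apply: eq_integral => x _; rewrite -ge0_mule_fsuml; last first.
    by move=> y; exact: nnfun_muleindic_ge0.
  by rewrite fsumEFin// -(fimfunE _ x).
rewrite ge0_integral_fsum//; last 2 first.
  - by move=> y; exact: emeasurable_funM.
  - by move=> y x _; rewrite mule_ge0// nnfun_muleindic_ge0.
apply: eq_fsbigr => r rh; rewrite (@integralZl_indic_nnsfun _ _ _ nu)//.
under [RHS]eq_integral do rewrite EFinM -muleA.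
rewrite ge0_integralZl//; last 3 first.
  - by apply: emeasurable_funM => //; exact/measurable_EFinP.
  - by move=> x _; rewrite mule_ge0 ?lee_fin.
  - by move: rh; rewrite inE => -[t _ <-]; rewrite lee_fin.
congr *%E; rewrite (@integral_indic _ _ _ nu)// setIT.
under [RHS]eq_integral do rewrite muleC.
rewrite -[LHS]/(\int[mu]_(x in _) f x) integral_mkcond.
by apply: eq_integral => x _; rewrite epatch_indic.
Qed.

End density_measure.

Section tuple_measure_unique.
Local Open Scope ereal_scope.
Context d (T : measurableType d) (R : realType) (n : nat).

Definition tuple_rectangle (B : 'I_n -> set T) : set (n.-tuple T) :=
  [set t | forall i, B i (tnth t i)].

Lemma measurable_tuple_rectangle (B : 'I_n -> set T) :
  (forall i, measurable (B i)) -> measurable (tuple_rectangle B).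
Proof.
move=> mB; rewrite (_ : tuple_rectangle B =
    \big[setI/setT]_(i < n) (fun t : n.-tuple T => tnth t i) @^-1` B i).
  apply: bigsetI_measurable => i _; rewrite -[X in measurable X]setTI.
  exact: measurable_tnth.
rewrite -bigcap_seq; apply/seteqP; split => t /=.
  by move=> tB i _; exact: tB.
by move=> tB i; apply: tB => /=; rewrite mem_index_enum.
Qed.

(** Rectangles are stable under intersection and generate the sigma-algebra of tuples; finiteness
    lets [setT] alone serve as the exhausting sequence. *)
Lemma tuple_measure_unique (m1 m2 : {measure set (n.-tuple T) -> \bar R}) :
  m1 setT < +oo ->
  (forall B, (forall i, measurable (B i)) ->
    m1 (tuple_rectangle B) = m2 (tuple_rectangle B)) ->
  forall A, measurable A -> m1 A = m2 A.
Proof.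
move=> m1oo m12.
pose G := [set A | exists2 B : 'I_n -> set T,
  (forall i, measurable (B i)) & A = tuple_rectangle B].
have GT : G setT by exists (fun=> setT) => //; apply/seteqP; split.
apply: (measure_unique G (fun=> setT)) => //.
- apply/seteqP; split.
    apply: smallest_sub; first exact: smallest_sigma_algebra.
    rewrite -bigcup_seq => A [/= i _ [B mB <-]]; apply: sub_sigma_algebra.
    (* A generator constrains one coordinate: it is the rectangle whose other sides are full. *)
    exists (fun j => if j == i then B else setT); first by move=> j; case: ifP.
    rewrite setTI; apply/seteqP; split => t /=.
      by move=> Bt j; case: ifP => // /eqP ->.
    by move=> /(_ i); rewrite eqxx.
  apply: smallest_sub; first exact: sigma_algebra_measurable.
  by move=> A [B mB ->]; exact: measurable_tuple_rectangle.
- move=> _ _ [A mA ->] [B mB ->].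
  exists (fun i => A i `&` B i) => [i|]; first exact: measurableI.
  apply/seteqP; split => t /=; first by move=> [At Bt] i; split.
  by move=> ABt; split => i; case: (ABt i).
- by rewrite bigcup_const//; exists 0%N.
- by move=> _ [B mB ->]; exact: m12.
Qed.

End tuple_measure_unique.

(** * Lebesgue measure of the plane *)

Section lebesgue_affine.
Local Open Scope ereal_scope.
Context (R : realType).
Local Notation leb := (@lebesgue_measure R).

(** Lebesgue measure and [a] times its image under x -> a x + b agree on half-open intervals, hence
    everywhere. *)
Lemma ge0_integral_lebesgue_affine (a b : R) (f : R -> \bar R) : (0 < a)%R ->
  measurable_fun setT f -> (forall x, 0 <= f x) ->
  a%:E * \int[leb]_x f (a * x + b)%R = \int[leb]_x f x.
Proof.
move=> a0 mf f0.
pose phi (x : measurableTypeR R) : measurableTypeR R := (a * x + b)%R.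
have mphi : measurable_fun setT phi.
  by apply: measurable_funD => //; exact: measurable_funM.
pose phi' : {mfun measurableTypeR R >-> measurableTypeR R} :=
  HB.pack phi (isMeasurableFun.Build _ _ _ _ _ mphi).
pose k := NngNum (ltW a0).
have E A : measurable A -> leb A = mscale k (pushforward leb phi') A.
  apply: (@lebesgue_measure_unique R (mscale k (pushforward leb phi'))).
  move=> _ [[u v] /= _ <-]; rewrite /mscale/= /pushforward/=.
  rewrite (_ : phi @^-1` _ = `](u - b) / a, (v - b) / a]%classic)%R; last first.
    apply/seteqP; split => x; rewrite /phi/= !in_itv/=.
      by rewrite ltr_pdivrMr// ler_pdivlMr// ltrBlDr lerBrDr ![(x * a)%R]mulrC.
    by rewrite ltr_pdivrMr// ler_pdivlMr// ltrBlDr lerBrDr ![(x * a)%R]mulrC.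
  rewrite !lebesgue_measure_itv/= !lte_fin ltr_pM2r ?invr_gt0// ltrD2r.
  case: ifP => _; last by rewrite mule0.
  by rewrite -!EFinB -EFinM; congr EFin; field; rewrite gt_eqF.
rewrite [RHS](eq_measure_integral (mscale k (pushforward leb phi')))//; last first.
  by move=> A mA _; exact: E.
rewrite ge0_integral_mscale//; congr *%E.
by rewrite ge0_integral_pushforward.
Qed.

Lemma ge0_integral_lebesgue_shift (b : R) (f : R -> \bar R) :
  measurable_fun setT f -> (forall x, 0 <= f x) ->
  \int[leb]_x f (x + b)%R = \int[leb]_x f x.
Proof.
move=> mf f0; have := ge0_integral_lebesgue_affine b (@ltr01 R) mf f0.
by rewrite mul1e => <-; under [RHS]eq_integral do rewrite mul1r.
Qed.

End lebesgue_affine.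

Section plane_integral.
Local Open Scope ereal_scope.
Context (R : realType).
Implicit Types (f : plane R -> \bar R) (z : plane R).
Local Notation leb := (@lebesgue_measure R).
Local Notation mu := (@lebesgue_plane R).

Lemma integral_plane_xy f : measurable_fun setT f -> (forall z, 0 <= f z) ->
  \int[mu]_z f z = \int[leb]_x \int[leb]_y f (x, y).
Proof. by move=> mf f0; rewrite -(fubini_tonelli1 f). Qed.

Lemma integral_plane_yx f : measurable_fun setT f -> (forall z, 0 <= f z) ->
  \int[mu]_z f z = \int[leb]_y \int[leb]_x f (x, y).
Proof. by move=> mf f0; rewrite -(fubini_tonelli2 f). Qed.

Lemma measurable_plane_pair d (T : measurableType d) (u v : T -> R) :
  measurable_fun setT u -> measurable_fun setT v ->
  measurable_fun setT (fun x => (u x, v x) : plane R).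
Proof. by move=> mu' mv; exact: measurable_fun_pair. Qed.

Let shearx (a : R) z : plane R := (z.1 + a * z.2, z.2)%R.
Let sheary (a : R) z : plane R := (z.1, z.2 + a * z.1)%R.

Let mshearx a : measurable_fun setT (shearx a).
Proof.
apply: measurable_plane_pair => //.
by apply: measurable_funD => //; exact: measurable_funM.
Qed.

Let msheary a : measurable_fun setT (sheary a).
Proof.
apply: measurable_plane_pair => //.
by apply: measurable_funD => //; exact: measurable_funM.
Qed.

Let integral_shearx a f : measurable_fun setT f -> (forall z, 0 <= f z) ->
  \int[mu]_z f (shearx a z) = \int[mu]_z f z.
Proof.
move=> mf f0; rewrite !integral_plane_yx//; last exact: measurableT_comp.
apply: eq_integral => y _.
apply: (@ge0_integral_lebesgue_shift R (a * y) (fun x => f (x, y)))%R => //.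
by apply: measurableT_comp => //; exact: measurable_fun_pair.
Qed.

Let integral_sheary a f : measurable_fun setT f -> (forall z, 0 <= f z) ->
  \int[mu]_z f (sheary a z) = \int[mu]_z f z.
Proof.
move=> mf f0; rewrite !integral_plane_xy//; last exact: measurableT_comp.
apply: eq_integral => x _.
apply: (@ge0_integral_lebesgue_shift R (a * x) (fun y => f (x, y)))%R => //.
by apply: measurableT_comp => //; exact: measurable_fun_pair.
Qed.

Definition plane_rotation (c s : R) z : plane R :=
  (c * z.1 - s * z.2, s * z.1 + c * z.2)%R.

Lemma measurable_plane_rotation c s : measurable_fun setT (plane_rotation c s).
Proof.
apply: measurable_plane_pair.
  by apply: measurable_funB; exact: measurable_funM.
by apply: measurable_funD; exact: measurable_funM.
Qed.

(* A rotation other than the half-turn is a product of three shears, each of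
   which preserves the measure by Fubini. *)
Lemma integral_plane_rotation (c s : R) f :
  (c ^+ 2 + s ^+ 2 = 1)%R -> (c != -1)%R ->
  measurable_fun setT f -> (forall z, 0 <= f z) ->
  \int[mu]_z f (plane_rotation c s z) = \int[mu]_z f z.
Proof.
(* With c = cos theta and s = sin theta, [a] is -tan(theta/2): the coefficient of the two outer
   shears, the middle one having coefficient [s]. *)
move=> cs c1 mf f0; pose a := (- s / (1 + c))%R.
have c1' : (1 + c != 0)%R by rewrite addrC addr_eq0.
have as1 : (1 + a * s = c)%R.
  rewrite /a; apply: (mulIf c1'); rewrite mulrDl mul1r mulrAC divfK//.
  by rewrite mulNr -expr2 -[(s ^+ 2)%R](addKr (c ^+ 2)%R) cs; ring.
have ac : (a + a * c = - s)%R by rewrite -{1}[a]mulr1 -mulrDr divfK.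
clearbody a; rewrite -[RHS](integral_shearx a)//.
have mf1 : measurable_fun setT (f \o shearx a) by exact: measurableT_comp.
have mf2 : measurable_fun setT (f \o shearx a \o sheary s).
  exact: measurableT_comp.
rewrite -[RHS](integral_sheary s mf1) => [|z]; last exact: f0.
rewrite -[RHS](integral_shearx a mf2) => [|z]; last exact: f0.
have ys (x y : R) : (y + s * (x + a * y) = s * x + c * y)%R.
  by rewrite -as1; ring.
have xs (x y : R) : (x + a * y + a * (s * x + c * y) = c * x - s * y)%R.
  transitivity ((1 + a * s) * x + (a + a * c) * y)%R; first by ring.
  by rewrite as1 ac mulNr.
apply: eq_integral => -[x y] _ /=; congr f.
rewrite /plane_rotation /shearx /sheary/=.
congr pair; first by rewrite -[LHS]xs -[in LHS]ys.
by rewrite -[LHS]ys.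
Qed.

Lemma integral_plane_scale (a : R) f : (0 < a)%R ->
  measurable_fun setT f -> (forall z, 0 <= f z) ->
  (a ^+ 2)%:E * \int[mu]_z f (a * z.1, a * z.2)%R = \int[mu]_z f z.
Proof.
move=> a0 mf f0; rewrite !integral_plane_xy//; last first.
  apply: measurableT_comp => //.
  by apply: measurable_plane_pair; exact: measurable_funM.
have mf1 x : measurable_fun setT (fun y => f (x, y)).
  by apply: measurableT_comp => //; exact: measurable_fun_pair.
rewrite -(@ge0_integral_lebesgue_affine _ a 0 (fun x => \int[leb]_y f (x, y)))//.
- rewrite expr2 EFinM -muleA; congr *%E; rewrite -ge0_integralZl//.
  + apply: eq_integral => x _.
    have := @ge0_integral_lebesgue_affine _ a 0 _ a0 (mf1 (a * x + 0)%R).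
    move=> <- //; rewrite addr0; congr *%E.
    by apply: eq_integral => y _; rewrite addr0.
  + have mfa : measurable_fun setT (fun z : plane R => f (a * z.1, a * z.2)%R).
      apply: measurableT_comp => //.
      by apply: measurable_plane_pair; exact: measurable_funM.
    exact: (@measurable_fun_fubini_tonelli_F _ _ _ _ _ leb _ mfa).
  + by move=> x _; exact: integral_ge0.
  + by rewrite lee_fin ltW.
- exact: (measurable_fun_fubini_tonelli_F f).
- by move=> x; exact: integral_ge0.
Qed.

Definition sqr_radius z : R := (z.1 ^+ 2 + z.2 ^+ 2)%R.

Lemma sqr_radius_ge0 z : (0 <= sqr_radius z)%R.
Proof. by rewrite addr_ge0// sqr_ge0. Qed.

Lemma measurable_sqr_radius : measurable_fun setT sqr_radius.
Proof. by apply: measurable_funD; exact: measurable_funX. Qed.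

(** Discs are indexed by the squared radius, so that their area is linear in [r], and are open, so
    that they are preimages of the rays that generate the Borel sets. *)
Let disc r := sqr_radius @^-1` `]-oo, r[.

Let mdisc r : measurable (disc r).
Proof. by rewrite -[X in measurable X]setTI; exact: measurable_sqr_radius. Qed.

Let disc0 r : (r <= 0)%R -> disc r = set0.
Proof.
move=> r0; rewrite -subset0 => z; rewrite /disc/= in_itv/= => /lt_le_trans.
by move=> /(_ _ r0); rewrite ltNge sqr_radius_ge0.
Qed.

Let disc1_fin : mu (disc 1%R) < +oo.
Proof.
pose I : set (measurableTypeR R) := `[(-1)%R, 1%R]%classic.
have mI : measurable I by exact: measurable_itv.
apply: (@le_lt_trans _ _ (mu (I `*` I))).
  apply: le_measure; rewrite ?inE; [exact: mdisc|exact: measurableX|].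
  move=> [x y]; rewrite /disc/sqr_radius/I/= !in_itv/= => xy1.
  by split; apply/andP; split; nra.
have Ioo : leb I < +oo.
  by rewrite lebesgue_measure_itv/=; case: ifP => _; rewrite -?EFinB ltry.
have IE : mu (I `*` I) = leb I * leb I by exact: product_measure1E.
by rewrite IE lte_mul_pinfty// ge0_fin_numE.
Qed.

Let disc_scale r : (0 < r)%R -> mu (disc r) = r%:E * mu (disc 1%R).
Proof.
(* Dilation by the square root of [r] maps the unit disc to [disc r] and multiplies areas by [r]. *)
move=> r0; have s0 : (0 < Num.sqrt r)%R by rewrite sqrtr_gt0.
rewrite -[in LHS](setIT (disc r)) -integral_indic//.
rewrite -(integral_plane_scale s0); last 2 first.
- by apply/measurable_EFinP; exact: measurable_indic.
- by move=> z; rewrite lee_fin.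
rewrite sqr_sqrtr ?ltW//; congr *%E; rewrite -(setIT (disc 1%R)) -integral_indic//.
apply: eq_integral => z _; congr EFin; rewrite !indicE.
have zE : (sqr_radius (Num.sqrt r * z.1, Num.sqrt r * z.2) < r)%R =
    (sqr_radius z < 1)%R.
  rewrite /sqr_radius/= !exprMn -mulrDr sqr_sqrtr ?ltW//.
  by rewrite -[X in (_ < X)%R]mulr1 ltr_pM2l.
by congr (nat_of_bool _)%:R; apply/idP/idP; rewrite !inE /disc/= !in_itv/= zE.
Qed.

(** The image of the planar measure and [c] times Lebesgue measure on the half-line agree on all
    open left rays, by linearity of the disc area. Here [c] is the area of the unit disc, whose
    value is left open. *)
Let pushforward_disc : exists2 c : R, (0 <= c)%R &
  forall g : R -> \bar R, measurable_fun setT g -> (forall t, 0 <= g t) ->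
  \int[mu]_z g (sqr_radius z) = c%:E * \int[leb]_(t in halfline R) g t.
Proof.
have c0 : (0 <= fine (mu (disc 1%R)))%R by exact: fine_ge0.
exists (fine (mu (disc 1%R))) => // g mg g0; set c := fine _ in c0 *.
have cE : mu (disc 1%R) = c%:E by rewrite fineK// ge0_fin_numE.
pose ind : measurableTypeR R -> \bar R := EFin \o \1_(halfline R).
have mhalf : measurable (halfline R) by exact: measurable_itv.
have mind : measurable_fun setT ind by exact/measurable_EFinP.
have ind0 t : 0 <= ind t by rewrite lee_fin.
pose sq' : plane R -> measurableTypeR R := sqr_radius.
have msq' : measurable_fun setT sq' by exact: measurable_sqr_radius.
pose sq : {mfun plane R >-> measurableTypeR R} :=
  HB.pack sq' (isMeasurableFun.Build _ _ _ _ _ msq').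
pose nu := mscale (NngNum c0) (density_measure leb mind ind0).
have nuE r : nu `]-oo, r[%classic = c%:E * leb (halfline R `&` `]-oo, r[).
  rewrite /nu /mscale/= /density_measure/=; congr *%E.
  by rewrite integral_indic//; exact: measurable_itv.
have E (A : set (measurableTypeR R)) :
    measurable A -> pushforward mu sq A = nu A.
  apply: (@measure_unique _ R (measurableTypeR R) (@RGenInftyO.G R)
    (fun n => `]-oo, n%:R[%classic) _ _ _ _ (pushforward mu sq) nu).
  - exact: RGenInftyO.measurableE.
  - move=> _ _ [x ->] [y ->]; exists (Num.min x y).
    by apply/seteqP; split => t /=; rewrite !in_itv/= lt_min => /andP.
  - by move=> n; exists n%:R.
  - apply/seteqP; split => // t _; exists (Num.truncn t).+1 => //=.
    by rewrite in_itv/= truncnS_gt.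
  - move=> _ [r ->]; transitivity (mu (disc r)) => //; rewrite -[RHS]/(nu _) nuE.
    have [r0|r0] := leP r 0%R.
      rewrite disc0// measure0 (_ : _ `&` _ = set0) ?measure0 ?mule0//.
      rewrite -subset0 => t []; rewrite /halfline/= !in_itv/= andbT => t0 tr.
      by move: (lt_le_trans tr r0); rewrite ltNge t0.
    rewrite disc_scale// cE muleC; congr *%E.
    rewrite (_ : _ `&` _ = `[0, r[%classic)%R.
      by rewrite lebesgue_measure_itv/= lte_fin r0 oppr0 adde0.
    by apply/seteqP; split => t; rewrite /halfline/= !in_itv/= andbT => /andP.
  - move=> n; rewrite -[X in X < _]/(mu (disc n%:R)).
    have [->|n0] := eqVneq n 0%N; first by rewrite disc0// measure0.
    by rewrite disc_scale ?ltr0n ?lt0n// cE -EFinM ltry.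
rewrite -[LHS](@ge0_integral_pushforward _ _ _ _ _ sq' msq' mu setT g)//.
rewrite (eq_measure_integral nu); last by move=> A mA _; exact: E.
rewrite ge0_integral_mscale//; congr *%E.
rewrite (ge0_integral_density_measure leb mind ind0)// [RHS]integral_mkcond.
by apply: eq_integral => t _; rewrite epatch_indic.
Qed.

(* The constant is identified by the Gaussian integral. *)
Lemma integral_plane_radial (g : R -> \bar R) :
  measurable_fun setT g -> (forall t, 0 <= g t) ->
  \int[mu]_z g (sqr_radius z) = pi%:E * \int[leb]_(t in halfline R) g t.
Proof.
have [c c0 cE] := pushforward_disc.
suff -> : pi = c by exact: cE.
pose e (t : R) := (expR (- t))%:E.
have me : measurable_fun setT e.
  by apply/measurable_EFinP; apply: measurableT_comp.
have e0 t : 0 <= e t by rewrite lee_fin expR_ge0.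
have /esym := cE e me e0.
rewrite (_ : \int[leb]_(t in _) e t = 1) ?mule1; last first.
  rewrite -(@integral_exponential_pdf R 1 ltr01) integral_mkcond.
  apply: eq_integral => t _; rewrite /exponential_pdf /halfline !patchE.
  by case: ifP => // _; rewrite mul1r mulN1r.
rewrite integral_plane_xy//; last first.
  by apply: measurableT_comp => //; exact: measurable_sqr_radius.
pose G := gauss_integral.gauss_fun (R := R).
have mG : measurable_fun setT (EFin \o G).
  by apply/measurable_EFinP; exact: gauss_integral.measurable_gauss_fun.
have G0 x : 0 <= (EFin \o G) x by rewrite lee_fin gauss_integral.gauss_fun_ge0.
under eq_integral => x _.
  rewrite (_ : \int[leb]_y e (sqr_radius (x, y)) =
      (EFin \o G) x * \int[leb]_y (EFin \o G) y).
    over.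
  rewrite -ge0_integralZl//; apply: eq_integral => y _ /=.
  by rewrite /e /sqr_radius/= /G /gauss_integral.gauss_fun -EFinM -expRD opprD.
rewrite ge0_integralZr//; last exact: integral_ge0.
rewrite gauss_integral.integralT_gauss -EFinM -expr2 sqr_sqrtr ?pi_ge0//.
by move=> [].
Qed.

End plane_integral.

(** * Powers of a measure *)

Lemma emeasurable_prod d (T : measurableType d) (R : realType) (I : Type)
    (s : seq I) (P : pred I) (g : I -> T -> \bar R) :
  (forall i, measurable_fun setT (g i)) ->
  measurable_fun setT (fun x => \prod_(i <- s | P i) g i x)%E.
Proof.
move=> mg; elim: s => [|i s IH].
  by under eq_fun do rewrite big_nil; exact: measurable_cst.
under eq_fun do rewrite big_cons; case: (P i) => //.
exact: emeasurable_funM.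
Qed.

Section power_measure_integral.
Local Open Scope ereal_scope.
Context d (T : measurableType d) (R : realType).
Variable mu : {sigma_finite_measure set T -> \bar R}.
Local Notation pw := (power_measure mu).

Lemma tnth_cons_pair0 n (z : T * n.-tuple T) : tnth (cons_pair z) ord0 = z.1.
Proof. by []. Qed.

Lemma tnth_cons_pairS n (z : T * n.-tuple T) (i : 'I_n) :
  tnth (cons_pair z) (lift ord0 i) = tnth z.2 i.
Proof. exact: tnthS. Qed.

Lemma integral_power_measure0 (f : 0.-tuple T -> \bar R) :
  measurable_fun setT f -> (forall z, 0 <= f z) ->
  \int[pw 0%N]_z f z = f [tuple].
Proof. by move=> mf f0; rewrite /= integral_dirac// diracT mul1e. Qed.

Lemma integral_power_measureS n (f : n.+1.-tuple T -> \bar R) :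
  measurable_fun setT f -> (forall z, 0 <= f z) ->
  \int[pw n.+1]_z f z = \int[mu]_x \int[pw n]_t f (cons_pair (x, t)).
Proof.
move=> mf f0; have mc := @measurable_cons_pair d T n.
rewrite -[LHS]/(\int[pushforward (mu \x pw n) (@cons_pair d T n)]_z f z).
rewrite (ge0_integral_pushforward mc)// preimage_setT.
apply: fubini_tonelli1; first exact: (measurableT_comp mf mc).
by move=> z; exact: f0.
Qed.

Lemma measurable_tuple_map n (phi : 'I_n -> T -> T) :
  (forall i, measurable_fun setT (phi i)) ->
  measurable_fun setT (fun z : n.-tuple T => [tuple phi i (tnth z i) | i < n]).
Proof.
move=> mphi; apply/measurable_fun_tnthP => i.
rewrite (_ : _ \o _ = fun z : n.-tuple T => phi i (tnth z i)).
  exact: (measurableT_comp (mphi i) (measurable_tnth i)).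
by apply/funext => z /=; rewrite tnth_mktuple.
Qed.

(** Induction with Fubini, one coordinate at a time. Each coordinate has its own map, as the
    rotations to be averaged use independent angles. *)
Lemma integral_power_measure_map n (phi : 'I_n -> T -> T) :
  (forall i, measurable_fun setT (phi i)) ->
  (forall i g, measurable_fun setT g -> (forall x, 0 <= g x) ->
    \int[mu]_x g (phi i x) = \int[mu]_x g x) ->
  forall f, measurable_fun setT f -> (forall z, 0 <= f z) ->
  \int[pw n]_z f [tuple phi i (tnth z i) | i < n] = \int[pw n]_z f z.
Proof.
elim: n phi => [|n IH] phi mphi phiE f mf f0.
  by apply: eq_integral => z _; congr f; apply: eq_from_tnth => -[].
have mphif := measurableT_comp mf (measurable_tuple_map mphi).
rewrite !integral_power_measureS//.
pose psi (i : 'I_n) := phi (lift ord0 i).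
have consE x (t : n.-tuple T) :
    [tuple phi i (tnth (cons_pair (x, t)) i) | i < n.+1] =
    cons_pair (phi ord0 x, [tuple psi i (tnth t i) | i < n]).
  apply: eq_from_tnth => i; rewrite tnth_mktuple.
  case: (unliftP ord0 i) => [j|] ->; last by rewrite !tnth_cons_pair0.
  by rewrite !tnth_cons_pairS tnth_mktuple.
have mfc : measurable_fun setT (f \o @cons_pair d T n).
  exact: (measurableT_comp mf (@measurable_cons_pair d T n)).
have mfx x : measurable_fun setT (fun t => f (cons_pair (x, t))).
  apply: (measurableT_comp mfc (g := fun t : n.-tuple T => (x, t))).
  exact: measurable_fun_pair.
transitivity (\int[mu]_x \int[pw n]_t f (cons_pair (phi ord0 x, t))).
  apply: eq_integral => x _; under eq_integral do rewrite consE.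
  apply: (IH psi _ _ (fun t => f (cons_pair (phi ord0 x, t)))); last 2 first.
    + exact: mfx.
    + by move=> z; exact: f0.
  - by move=> i; exact: mphi.
  - by move=> i; exact: phiE.
apply: (phiE ord0 (fun x => \int[pw n]_t f (cons_pair (x, t)))).
  apply: (@measurable_fun_fubini_tonelli_F _ _ _ _ _ (pw n) _ mfc) => z.
  exact: f0.
by move=> x; exact: integral_ge0.
Qed.

Lemma integral_power_measure_prod n (g : 'I_n -> T -> \bar R) :
  (forall i, measurable_fun setT (g i)) -> (forall i x, 0 <= g i x) ->
  \int[pw n]_z \prod_(i < n) g i (tnth z i) = \prod_(i < n) \int[mu]_x g i x.
Proof.
elim: n g => [|n IH] g mg g0.
  under eq_integral do rewrite big_ord0.
  by rewrite integral_power_measure0// big_ord0.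
have mp m (h : 'I_m -> T -> \bar R) : (forall i, measurable_fun setT (h i)) ->
    measurable_fun setT (fun z : m.-tuple T => \prod_(i < m) h i (tnth z i)).
  move=> mh; apply: emeasurable_prod => i.
  exact: (measurableT_comp (mh i) (measurable_tnth i)).
rewrite integral_power_measureS//; first last.
- by move=> z; exact: prode_ge0.
- exact: mp.
rewrite big_ord_recl -IH//.
rewrite -ge0_integralZr//; last by apply: integral_ge0 => z _; exact: prode_ge0.
apply: eq_integral => x _; rewrite -ge0_integralZl//.
- apply: eq_integral => z _; rewrite big_ord_recl; congr *%E.
  by apply: eq_bigr => i _; rewrite tnth_cons_pairS.
- exact: (mp n (fun i => g (lift ord0 i))).
- by move=> z _; exact: prode_ge0.
Qed.

End power_measure_integral.

(** * Averaging the Vandermonde determinant *)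

Section complex_modulus.
Context (R : realType).
Implicit Types (x y : R[i]) (z : plane R).

Lemma normr_cmod x : `|x| = (cmod x)%:C%C.
Proof. by case: x. Qed.

Lemma cmod_prod (I : finType) (P : pred I) (f : I -> R[i]) :
  cmod (\prod_(i | P i) f i) = \prod_(i | P i) cmod (f i).
Proof.
apply: (big_morph (@cmod R)); first exact: ComplexField.Normc.normcM.
exact: ComplexField.Normc.normc1.
Qed.

Lemma cmodX x n : cmod (x ^+ n) = cmod x ^+ n.
Proof.
elim: n => [|n IH]; first exact: ComplexField.Normc.normc1.
by rewrite !exprS -IH; exact: ComplexField.Normc.normcM.
Qed.

Lemma cmod_ge0 x : 0 <= cmod x.
Proof. by case: x => a b; exact: sqrtr_ge0. Qed.

Lemma cmodBC x y : cmod (x - y) = cmod (y - x).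
Proof. by apply: complexI; rewrite -!normr_cmod distrC. Qed.

Lemma sqr_cmod_cplx z : cmod (cplx z) ^+ 2 = sqr_radius z.
Proof. by rewrite sqr_sqrtr//; exact: sqr_radius_ge0. Qed.

Lemma cplx_rotation (w : R[i]) z :
  cplx (plane_rotation (complex.Re w) (complex.Im w) z) = w * cplx z.
Proof.
by case: w => c s /=; rewrite /plane_rotation/cplx/=; congr Complex; rewrite addrC.
Qed.

(** A power of [w] may be -1, the half-turn that the shear decomposition excludes; so rotating by
    [w ^+ n] is done as [n] rotations by [w]. *)
Lemma integral_iter_rotation (w : R[i]) n (f : plane R -> \bar R) :
  `|w| = 1 -> w != -1 -> measurable_fun setT f -> (forall z, 0 <= f z)%E ->
  (\int[@lebesgue_plane R]_z
     f (iter n (plane_rotation (complex.Re w) (complex.Im w)) z) =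
   \int[@lebesgue_plane R]_z f z)%E.
Proof.
move=> w1 wN1; elim: n f => [//|n IH] f mf f0.
have mr := @measurable_plane_rotation R (complex.Re w) (complex.Im w).
rewrite (IH (f \o plane_rotation (complex.Re w) (complex.Im w))); last 2 first.
- exact: measurableT_comp.
- by move=> z; exact: f0.
apply: integral_plane_rotation => //.
  by apply: complexI; rewrite add_Re2_Im2 w1 expr1n.
(* On the unit circle, real part -1 forces imaginary part 0. *)
apply: contra_neq wN1 => cN1; apply/eqP; rewrite eq_complex/= cN1 eqxx/= oppr0.
have : (complex.Re w ^+ 2 + complex.Im w ^+ 2)%:C%C = 1.
  by rewrite add_Re2_Im2 w1 expr1n.
move=> /complexI; rewrite cN1 sqrrN expr1n -[RHS]addr0.
by move=> /addrI /eqP; rewrite sqrf_eq0.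
Qed.

Lemma cplx_iter_rotation (w : R[i]) n z :
  cplx (iter n (plane_rotation (complex.Re w) (complex.Im w)) z) =
  w ^+ n * cplx z.
Proof.
elim: n => [|n IH]; first by rewrite mul1r.
by rewrite iterS cplx_rotation IH mulrA -exprS.
Qed.

End complex_modulus.

Section vandermonde_average.
Context (R : realType) (N p : nat).
Implicit Types z : N.-tuple (plane R).
Local Notation Delta_p := (vandermonde_poly N ^+ p).
Local Notation supp := (mpoly.msupp Delta_p).

(** This is |Delta(z)|^(2p), written exactly as in [beta_weight] so that the two match by
    conversion. *)
Definition sqr_vandermonde z : R :=
  \prod_(ij : 'I_N * 'I_N | (ij.1 < ij.2)%N)
    cmod (cplx (tnth z ij.1) - cplx (tnth z ij.2)) `^ (2 * p)%:R.

Lemma mmap_vandermonde (v : 'I_N -> R[i]) :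
  mpoly.mmap intr v (vandermonde_poly N) =
  \prod_(ij : 'I_N * 'I_N | (ij.1 < ij.2)%N) (v ij.2 - v ij.1).
Proof.
rewrite /vandermonde_poly det_Vandermonde rmorph_prod/=.
under eq_bigr do rewrite rmorph_prod/=.
rewrite pair_big_dep/=; apply: eq_bigr => -[i j] _ /=.
by rewrite !mxE rmorphB/= !mpoly.mmapX !mpoly.mmap1U.
Qed.

Lemma sqr_vandermondeE z :
  sqr_vandermonde z =
  cmod (mpoly.mmap intr (fun i => cplx (tnth z i)) Delta_p) ^+ 2.
Proof.
rewrite rmorphXn/= mmap_vandermonde cmodX cmod_prod -exprM mulnC -prodrXl.
apply: eq_bigr => ij _; rewrite cmodBC.
by rewrite -powR_mulrn// cmod_ge0.
Qed.

Definition monomial (m : mpoly.multinom N) (t : 'I_N -> R) : R :=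
  \prod_i t i ^+ m i.

(** The polynomial D(t) of the overview. *)
Definition radial_average (t : 'I_N -> R) : R :=
  \sum_(m <- supp) (mpoly.mcoeff m Delta_p)%:~R ^+ 2 * monomial m t.

(* It bounds the exponents of Delta^p, and a primitive root of that order is
   not -1. *)
Let M := (mpoly.mmeasure mpoly.mdeg Delta_p + 3)%N.

Let supp_bound m : m \in supp -> forall i, (m i < M)%N.
Proof.
move=> /mpoly.msize_mdeg_lt mM i; apply: (@leq_ltn_trans (mpoly.mdeg m)).
  by rewrite mpoly.mdegE (bigD1 i)//= leq_addr.
by rewrite /M addnC ltn_addl.
Qed.

Let sum_sqr_vandermonde (w : R[i]) z : M.-primitive_root w ->
  \sum_(k : {ffun 'I_N -> 'I_M})
    sqr_vandermonde [tuple iter (k i)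
      (plane_rotation (complex.Re w) (complex.Im w)) (tnth z i) | i < N] =
  (M ^ N)%:R * radial_average (sqr_radii z).
Proof.
(* Parseval is an identity in [R[i]]; the real one follows by injectivity of the embedding. *)
move=> Mw; apply: complexI; rewrite rmorphM rmorph_nat rmorph_sum/=.
have cE (x : R[i]) : ((cmod x) ^+ 2)%:C%C = `|x| ^+ 2.
  by rewrite rmorphXn/= normr_cmod.
rewrite (eq_bigr (fun k : {ffun 'I_N -> 'I_M} =>
    `|mpoly.mmap intr (fun i => w ^+ k i * cplx (tnth z i)) Delta_p| ^+ 2)).
  rewrite (parseval_mpoly _ Mw supp_bound); congr (_ * _).
  rewrite /radial_average rmorph_sum/=; apply: eq_bigr => m _.
  rewrite rmorphM/= rmorphXn/= rmorph_int; congr (_ * _).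
  rewrite rmorph_prod/=; apply: eq_bigr => i _.
  by rewrite rmorphXn/= -cE.
move=> k _; rewrite sqr_vandermondeE cE; congr (`|_| ^+ 2).
rewrite /mpoly.mmap; apply: eq_bigr => m _; congr (_ * _).
apply: eq_bigr => i _; congr (_ ^+ _).
by rewrite tnth_mktuple cplx_iter_rotation.
Qed.

Lemma measurable_sqr_radii i : measurable_fun setT (fun z => sqr_radii z i).
Proof.
rewrite (_ : (fun z => _) = sqr_radius (R := R) \o (@tnth _ _ ^~ i)).
  by apply: measurableT_comp; [exact: measurable_sqr_radius|exact: measurable_tnth].
by apply/funext => z; rewrite /sqr_radii sqr_cmod_cplx.
Qed.

Lemma sqr_radii_ge0 z i : 0 <= sqr_radii z i.
Proof. exact: sqr_ge0. Qed.

Lemma measurable_monomial m :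
  measurable_fun setT (fun z => monomial m (sqr_radii z)).
Proof.
apply: measurable_prod => i _; apply: measurable_funX.
exact: measurable_sqr_radii.
Qed.

Lemma monomial_ge0 m (t : 'I_N -> R) :
  (forall i, 0 <= t i) -> 0 <= monomial m t.
Proof. by move=> t0; apply: prodr_ge0 => i _; exact: exprn_ge0. Qed.

Lemma measurable_radial_average :
  measurable_fun setT (fun z => radial_average (sqr_radii z)).
Proof.
apply: measurable_sum => m; apply: measurable_funM => //.
exact: measurable_monomial.
Qed.

Lemma radial_average_ge0 (t : 'I_N -> R) :
  (forall i, 0 <= t i) -> 0 <= radial_average t.
Proof.
by move=> t0; apply: sumr_ge0 => m _; rewrite mulr_ge0 ?sqr_ge0 ?monomial_ge0.
Qed.

Lemma sqr_vandermonde_ge0 z : 0 <= sqr_vandermonde z.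
Proof. by apply: prodr_ge0 => ij _; exact: powR_ge0. Qed.

Lemma measurable_sqr_vandermonde : measurable_fun setT sqr_vandermonde.
Proof.
have mt (i : 'I_N) : measurable_fun setT (fun z => tnth z i).
  exact: measurable_tnth.
have m1 i : measurable_fun setT (fun z => (tnth z i).1).
  exact: (measurableT_comp measurable_fst (mt i)).
have m2 i : measurable_fun setT (fun z => (tnth z i).2).
  exact: (measurableT_comp measurable_snd (mt i)).
rewrite /sqr_vandermonde.
under eq_fun do rewrite -big_filter.
apply: measurable_prod => -[i j] _ /=.
(* The exponent 2p is even, so each factor is a polynomial in the real coordinates. *)
rewrite (_ : (fun z => _) = (fun z =>
    sqr_radius ((tnth z i).1 - (tnth z j).1, (tnth z i).2 - (tnth z j).2) ^+ p)).
  apply: measurable_funX.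
  have md : measurable_fun setT (fun z => ((tnth z i).1 - (tnth z j).1,
      (tnth z i).2 - (tnth z j).2) : plane R).
    by apply: measurable_plane_pair;
      [exact: (measurable_funB (m1 i) (m1 j))|
       exact: (measurable_funB (m2 i) (m2 j))].
  exact: (measurableT_comp (@measurable_sqr_radius R) md).
apply/funext => z; rewrite powR_mulrn ?cmod_ge0// exprM; congr (_ ^+ _).
by rewrite -sqr_cmod_cplx.
Qed.

(** Rotating the coordinates changes neither the integral nor [h]. Summing over all M^N choices of
    rotations turns the integrand into M^N D(t) h by Parseval, and M^N is cancelled at the end. *)
Lemma integral_radial_average (h : N.-tuple (plane R) -> \bar R) :
  measurable_fun setT h -> (forall z, 0 <= h z)%E ->
  (forall z z', sqr_radii z =1 sqr_radii z' -> h z = h z') ->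
  (\int[lebesgue_CN R N]_z ((sqr_vandermonde z)%:E * h z) =
   \int[lebesgue_CN R N]_z ((radial_average (sqr_radii z))%:E * h z))%E.
Proof.
move=> mh h0 hrad.
have [w Mw] := @prim_root_exists R[i] M (ltn_addl _ (ltn0Sn 2)).
have w1 := norm_prim_root Mw.
have wN1 : w != -1.
  apply/eqP => wE; have := eq_prim_root_expr Mw 2 0.
  by rewrite wE sqrrN expr1n expr0 eqxx mod0n modn_small// /M addnC.
pose rot (k : {ffun 'I_N -> 'I_M}) (i : 'I_N) (x : plane R) :=
  iter (k i) (plane_rotation (complex.Re w) (complex.Im w)) x.
have mrot k i : measurable_fun setT (rot k i).
  rewrite /rot; elim: (nat_of_ord (k i)) => [|n IH]; first exact: measurable_id.
  by apply: (measurableT_comp (measurable_plane_rotation _ _) IH).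
have hrot k z : h [tuple rot k i (tnth z i) | i < N] = h z.
  apply: hrad => i; rewrite /sqr_radii tnth_mktuple cplx_iter_rotation.
  rewrite [cmod _]ComplexField.Normc.normcM -[X in X * _]/(cmod _) cmodX.
  suff -> : cmod w = 1 by rewrite expr1n mul1r.
  by apply: complexI; rewrite -normr_cmod w1.
have mvh : measurable_fun setT (fun z => (sqr_vandermonde z)%:E * h z)%E.
  apply: emeasurable_funM => //.
  by apply/measurable_EFinP; exact: @measurable_sqr_vandermonde.
have mdh : measurable_fun setT
    (fun z => (radial_average (sqr_radii z))%:E * h z)%E.
  apply: emeasurable_funM => //.
  by apply/measurable_EFinP; exact: @measurable_radial_average.
have vh0 z : (0 <= (sqr_vandermonde z)%:E * h z)%E.
  by rewrite mule_ge0// lee_fin sqr_vandermonde_ge0.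
have rotE k : (\int[lebesgue_CN R N]_z ((sqr_vandermonde z)%:E * h z) =
    \int[lebesgue_CN R N]_z
      ((sqr_vandermonde [tuple rot k i (tnth z i) | i < N])%:E * h z))%E.
  rewrite -(@integral_power_measure_map _ _ _ (@lebesgue_plane R) N (rot k))//.
    by apply: eq_integral => z _; rewrite hrot.
  by move=> i g mg g0; exact: integral_iter_rotation.
have MN0 : (M ^ N)%:R != 0 :> R by rewrite pnatr_eq0 expn_eq0 /M addnC.
suff : ((M ^ N)%:R%:E * \int[lebesgue_CN R N]_z ((sqr_vandermonde z)%:E * h z) =
  (M ^ N)%:R%:E * \int[lebesgue_CN R N]_z
     ((radial_average (sqr_radii z))%:E * h z))%E.
  move=> /(congr1 (fun x => ((M ^ N)%:R^-1)%:E * x)%E).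
  by rewrite !muleA -EFinM mulVf// !mul1e.
transitivity (\sum_(k : {ffun 'I_N -> 'I_M})
    \int[lebesgue_CN R N]_z ((sqr_vandermonde z)%:E * h z))%E.
  have -> : (M ^ N)%:R = \sum_(k : {ffun 'I_N -> 'I_M}) 1 :> R.
    by rewrite sumr_const card_ffun !card_ord.
  by rewrite -sumEFin ge0_sume_distrl//; apply: eq_bigr => k _; rewrite mul1e.
under eq_bigr => k _ do rewrite (rotE k).
rewrite -ge0_integral_sum//; last 2 first.
- move=> k; apply: emeasurable_funM => //; apply/measurable_EFinP.
  exact: (measurableT_comp measurable_sqr_vandermonde
    (measurable_tuple_map (mrot k))).
- by move=> k z _; rewrite mule_ge0// lee_fin sqr_vandermonde_ge0.
rewrite -ge0_integralZl//; last first.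
  move=> z _; rewrite mule_ge0// lee_fin radial_average_ge0//.
  exact: sqr_radii_ge0.
apply: eq_integral => z _.
rewrite muleA -EFinM -(sum_sqr_vandermonde _ Mw) -sumEFin ge0_sume_distrl//.
by move=> k _; rewrite lee_fin sqr_vandermonde_ge0.
Qed.

End vandermonde_average.

(** * Laws of the squared radii *)

Lemma measurable_expeR (R : realType) : measurable_fun setT (@expeR R).
Proof.
pose f (x : \bar R) := if x == +oo%E then +oo%E else
  if x == -oo%E then 0%E else (expR (fine x))%:E.
rewrite (_ : @expeR R = f); last by apply/funext; case.
have meq (y : \bar R) : measurable_fun setT (fun x : \bar R => x == y).
  apply: (measurable_fun_bool true); rewrite setTI.
  rewrite (_ : _ @^-1` _ = [set y]); first exact: emeasurable_set1.
  by apply/seteqP; split => x /=; [move/eqP|move=> ->; exact: eqxx].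
apply: measurable_fun_ifT => //; apply: measurable_fun_ifT => //.
by apply/measurable_EFinP; apply: measurableT_comp.
Qed.

Section radial_law.
Context (R : realType) (V : R -> \bar R).
Hypothesis V_fin : forall t : R, 0 <= t -> V t != -oo%E.
Hypothesis V_meas : measurable_fun (halfline R) V.
Local Open Scope ereal_scope.
Local Notation leb := (@lebesgue_measure R).

Lemma measurable_halfline : measurable (halfline R).
Proof. exact: measurable_itv. Qed.

Lemma halflineP (t : R) : halfline R t <-> (0 <= t)%R.
Proof. by rewrite /halfline/= in_itv/= andbT. Qed.

(** [V] is constrained on the half-line only; cutting e^(-V) off to 0 elsewhere makes it measurable,
    nonnegative and finite on the whole line. *)
Definition expNV : R -> \bar R := (fun t => expeR (- V t)) \_ (halfline R).

Lemma expNVE t : (0 <= t)%R -> expNV t = expeR (- V t).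
Proof. by move=> t0; rewrite /expNV patchE ifT// inE; apply/halflineP. Qed.

Lemma expNV_lt0 t : (t < 0)%R -> expNV t = 0.
Proof.
move=> t0; rewrite /expNV patchE ifF//; apply/negP.
by rewrite inE => /halflineP; rewrite leNgt t0.
Qed.

Lemma expNV_ge0 t : 0 <= expNV t.
Proof. by rewrite /expNV patchE; case: ifP => // _; exact: expeR_ge0. Qed.

Lemma expNV_fin t : expNV t \is a fin_num.
Proof.
have [t0|t0] := leP 0%R t; last by rewrite expNV_lt0.
by rewrite expNVE//; case: (V t) (V_fin t0).
Qed.

Lemma measurable_expNV : measurable_fun setT expNV.
Proof.
apply/(measurable_restrictT _ measurable_halfline).
apply: (measurableT_comp (@measurable_expeR R) (g := fun t => - V t)).
exact: measurableT_comp.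
Qed.

Definition radial_weight (n : nat) (t : R) : \bar R := (t ^+ n)%:E * expNV t.

Lemma measurable_radial_weight n : measurable_fun setT (radial_weight n).
Proof.
apply: emeasurable_funM; last exact: measurable_expNV.
by apply/measurable_EFinP; exact: measurable_funX.
Qed.

Lemma radial_weight_ge0 n t : 0 <= radial_weight n t.
Proof.
have [t0|t0] := leP 0%R t; last by rewrite /radial_weight expNV_lt0 ?mule0.
by rewrite mule_ge0 ?expNV_ge0// lee_fin exprn_ge0.
Qed.

(** This includes t = 0, where both kinds of power give 1 at exponent 0. *)
Lemma radial_weight_gammaV n t : (0 <= t)%R ->
  radial_weight n t = gammaV_weight V (1 + n%:R) t.
Proof.
move=> t0; rewrite /radial_weight /gammaV_weight expNVE//.
by rewrite addrAC subrr add0r powR_mulrn.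
Qed.

Lemma integral_radial_weight n (B : set (measurableTypeR R)) : measurable B ->
  \int[@lebesgue_plane R]_x
     ((\1_B (sqr_radius x))%:E * radial_weight n (sqr_radius x)) =
  pi%:E * \int[leb]_(t in B `&` halfline R) gammaV_weight V (1 + n%:R) t.
Proof.
move=> mB; pose g t := (\1_B t)%:E * radial_weight n t.
rewrite (@integral_plane_radial R g); last 2 first.
- apply: emeasurable_funM; last exact: measurable_radial_weight.
  by apply/measurable_EFinP; exact: measurable_indic.
- by move=> t; rewrite mule_ge0 ?lee_fin// radial_weight_ge0.
congr *%E; rewrite setIC integral_mkcondr; apply: eq_integral => t.
rewrite inE => /halflineP t0; rewrite epatch_indic/= /g muleC.
by rewrite radial_weight_gammaV.
Qed.

Section powers.
Variable N : nat.
Implicit Types (z : N.-tuple (plane R)) (m : mpoly.multinom N).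

Definition radii z : N.-tuple (measurableTypeR R) :=
  [tuple sqr_radii z i | i < N].

Lemma measurable_radii : measurable_fun setT radii.
Proof.
apply/measurable_fun_tnthP => i.
rewrite (_ : _ \o _ = fun z => sqr_radii z i); first exact: measurable_sqr_radii.
by apply/funext => z /=; rewrite tnth_mktuple.
Qed.

HB.instance Definition _ :=
  isMeasurableFun.Build _ _ _ _ radii measurable_radii.

Definition prod_expNV z : \bar R := \prod_(i < N) expNV (sqr_radii z i).

Lemma prod_expNV_ge0 z : 0 <= prod_expNV z.
Proof. by apply: prode_ge0 => i _; exact: expNV_ge0. Qed.

Lemma prod_expNV_fin z : prod_expNV z \is a fin_num.
Proof. by apply: prode_fin_num => i _; exact: expNV_fin. Qed.

Lemma measurable_prod_expNV : measurable_fun setT prod_expNV.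
Proof.
apply: emeasurable_prod => i.
exact: (measurableT_comp measurable_expNV (measurable_sqr_radii i)).
Qed.

Definition monomial_weight m z : \bar R :=
  (monomial m (sqr_radii z))%:E * prod_expNV z.

Lemma monomial_weightE m z :
  monomial_weight m z = \prod_(i < N) radial_weight (m i) (sqr_radii z i).
Proof. by rewrite /monomial_weight /monomial -prodEFin -big_split. Qed.

Lemma monomial_weight_ge0 m z : 0 <= monomial_weight m z.
Proof.
rewrite mule_ge0 ?prod_expNV_ge0// lee_fin monomial_ge0// => i.
exact: sqr_radii_ge0.
Qed.

Lemma measurable_monomial_weight m : measurable_fun setT (monomial_weight m).
Proof.
apply: emeasurable_funM; last exact: measurable_prod_expNV.
by apply/measurable_EFinP; exact: measurable_monomial.
Qed.

(** The [m]-th component of the mixture, left unnormalised since its mass may be infinite for a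
    general [m]. When the mass is finite and positive, normalising gives the product of the Gamma_V
    laws of parameters 1 + m_i. *)
Definition radial_law m : set (N.-tuple (measurableTypeR R)) -> \bar R :=
  pushforward (density_measure (lebesgue_CN R N)
    (measurable_monomial_weight m) (monomial_weight_ge0 m)) radii.

Let radial_law0 m : radial_law m set0 = 0.
Proof. exact: measure0. Qed.

Let radial_law_ge0 m A : 0 <= radial_law m A.
Proof. exact: measure_ge0. Qed.

Let radial_law_sigma_additive m : semi_sigma_additive (radial_law m).
Proof. exact: measure_semi_sigma_additive. Qed.

HB.instance Definition _ m := isMeasure.Build _ _ _ (radial_law m)
  (@radial_law0 m) (@radial_law_ge0 m) (@radial_law_sigma_additive m).

Lemma radial_lawE m A : measurable A ->
  radial_law m A =
  \int[lebesgue_CN R N]_z ((\1_A (radii z))%:E * monomial_weight m z).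
Proof.
move=> mA; rewrite -[LHS]/(\int[_]_(z in radii @^-1` A) _) integral_mkcond.
by apply: eq_integral => z _; rewrite epatch_indic/= muleC.
Qed.

(** The indicator of a rectangle and the weight both split over the coordinates, so the integral is
    a product of planar radial integrals, each with its factor pi. *)
Lemma radial_law_rectangle m (B : 'I_N -> set (measurableTypeR R)) :
  (forall i, measurable (B i)) ->
  radial_law m (tuple_rectangle B) =
  \prod_(i < N) (pi%:E *
    \int[leb]_(t in B i `&` halfline R) gammaV_weight V (1 + (m i)%:R) t).
Proof.
move=> mB; rewrite radial_lawE; last exact: measurable_tuple_rectangle.
pose g (i : 'I_N) (x : plane R) :=
  (\1_(B i) (sqr_radius x))%:E * radial_weight (m i) (sqr_radius x).
rewrite (eq_integral (fun z => \prod_(i < N) g i (tnth z i))); last first.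
  move=> z _; rewrite monomial_weightE.
  transitivity ((\prod_(i < N) \1_(B i) (sqr_radius (tnth z i)))%R%:E *
      \prod_(i < N) radial_weight (m i) (sqr_radius (tnth z i))); last first.
    by rewrite -prodEFin -big_split.
  congr (_%:E * _); last first.
    by apply: eq_bigr => i _; rewrite /sqr_radii sqr_cmod_cplx.
  rewrite !indicE; have [Bz|nBz] := boolP (radii z \in _).
    rewrite big1// => i _; rewrite indicE mem_set//.
    by have := set_mem Bz => /(_ i); rewrite tnth_mktuple /sqr_radii sqr_cmod_cplx.
  apply/esym/eqP; rewrite prodf_seq_eq0; apply: contraNT nBz.
  rewrite -all_predC => /allP /= zB; apply/mem_set => i.
  have := zB i (mem_index_enum i); rewrite tnth_mktuple.
  rewrite /sqr_radii sqr_cmod_cplx /= indicE.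
  by have [/set_mem//|_] := boolP (_ \in B i); rewrite eqxx.
rewrite integral_power_measure_prod; last 2 first.
- move=> i; apply: emeasurable_funM.
    apply/measurable_EFinP; apply: (measurableT_comp _ (@measurable_sqr_radius R)).
    by apply: measurable_indic; exact: mB.
  exact: (measurableT_comp (measurable_radial_weight _) (@measurable_sqr_radius R)).
- by move=> i x; rewrite mule_ge0 ?lee_fin// radial_weight_ge0.
by apply: eq_bigr => i _; rewrite integral_radial_weight.
Qed.

Lemma radial_lawT m :
  radial_law m setT = \prod_(i < N) (pi%:E * GammaV V (1 + (m i)%:R)).
Proof.
rewrite (_ : setT = tuple_rectangle (fun=> setT)); last exact/seteqP.
rewrite radial_law_rectangle//; apply: eq_bigr => i _.
by rewrite setTI.
Qed.

End powers.
End radial_law.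

(** * The posterior weights *)

Section ensemble_radii.
Context (R : realType) (V : R -> \bar R) (N p : nat).
Hypothesis hN : (0 < N)%N.
Hypothesis V_fin : forall t : R, 0 <= t -> V t != -oo%E.
Hypothesis V_meas : measurable_fun (halfline R) V.
Hypothesis V_wd : beta_well_defined N (2 * p)%:R V.
Local Open Scope ereal_scope.
Local Notation leb := (@lebesgue_measure R).
Implicit Types (z : N.-tuple (plane R)) (m : mpoly.multinom N).
Local Notation Delta_p := (vandermonde_poly N ^+ p)%R.
Local Notation supp := (mpoly.msupp Delta_p).
Local Notation law := (radial_law V_meas).
Local Notation weight := (@beta_weight R N (2 * p)%:R V).

Definition sqr_coef m : R := ((mpoly.mcoeff m Delta_p)%:~R ^+ 2)%R.

Lemma sqr_coef_gt0 m : m \in supp -> (0 < sqr_coef m)%R.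
Proof.
rewrite mpoly.mcoeff_msupp => m0.
by rewrite /sqr_coef lt_neqAle sqr_ge0 andbT eq_sym sqrf_eq0 intr_eq0.
Qed.

Lemma sqr_coef_ge0 m : (0 <= sqr_coef m)%R. Proof. exact: sqr_ge0. Qed.

Lemma beta_weightE z : weight z = (sqr_vandermonde p z)%:E * prod_expNV V z.
Proof.
congr (_ * _); apply: eq_bigr => i _.
by rewrite expNVE//; exact: sqr_radii_ge0.
Qed.

Lemma measurable_beta_weight : measurable_fun setT weight.
Proof.
rewrite (funext beta_weightE).
apply: emeasurable_funM; last exact: measurable_prod_expNV.
by apply/measurable_EFinP; exact: measurable_sqr_vandermonde.
Qed.

Lemma beta_weight_ge0 z : 0 <= weight z.
Proof.
rewrite beta_weightE mule_ge0 ?prod_expNV_ge0//.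
by rewrite lee_fin sqr_vandermonde_ge0.
Qed.

Lemma beta_weight_fin z : weight z \is a fin_num.
Proof. by rewrite beta_weightE fin_numM// (prod_expNV_fin V_fin). Qed.

Lemma radiiP z z' : sqr_radii z =1 sqr_radii z' <-> radii z = radii z'.
Proof.
split => [zz'|zz' i]; first by apply: eq_from_tnth => i; rewrite !tnth_mktuple.
by have := congr1 (@tnth _ _ ^~ i) zz'; rewrite !tnth_mktuple.
Qed.

Lemma integral_radial_beta_weight (h : N.-tuple (plane R) -> \bar R) :
  measurable_fun setT h -> (forall z, 0 <= h z) ->
  (forall z z', sqr_radii z =1 sqr_radii z' -> h z = h z') ->
  \int[lebesgue_CN R N]_z (h z * weight z) =
  \int[lebesgue_CN R N]_z
     ((radial_average p (sqr_radii z))%:E * (h z * prod_expNV V z)).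
Proof.
move=> mh h0 hrad; rewrite -integral_radial_average; last 3 first.
- by apply: emeasurable_funM => //; exact: measurable_prod_expNV.
- by move=> z; rewrite mule_ge0// prod_expNV_ge0.
- move=> z z' zz'; rewrite (hrad _ _ zz'); congr *%E.
  by apply: eq_bigr => i _; rewrite zz'.
by apply: eq_integral => z _; rewrite beta_weightE muleCA.
Qed.

(** The averaged weight is expanded monomial by monomial. This gives both the normalisation of the
    latent weights and the control of each Gamma_V(1 + m_i). *)
Lemma beta_massE : beta_mass N (2 * p)%:R V =
  \sum_(m <- supp) (sqr_coef m)%:E * law m setT.
Proof.
rewrite /beta_mass.
transitivity (\int[lebesgue_CN R N]_z (cst 1 z * weight z)).
  by apply: eq_integral => z _; rewrite mul1e.
rewrite integral_radial_beta_weight//.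
transitivity (\int[lebesgue_CN R N]_z
    \sum_(m <- supp) ((sqr_coef m)%:E * monomial_weight V m z)).
  apply: eq_integral => z _; rewrite mul1e /radial_average -sumEFin.
  rewrite ge0_sume_distrl; last first.
    move=> m _; rewrite lee_fin mulr_ge0 ?sqr_ge0// monomial_ge0// => i.
    exact: sqr_radii_ge0.
  by apply: eq_bigr => m _; rewrite EFinM -muleA.
rewrite ge0_integral_sum//; last 2 first.
- by move=> m; apply: measurable_funeM; exact: measurable_monomial_weight.
- by move=> m z _; rewrite mule_ge0 ?lee_fin ?sqr_coef_ge0// monomial_weight_ge0.
apply: eq_bigr => m _; rewrite ge0_integralZl ?lee_fin ?sqr_coef_ge0//.
  exact: measurable_monomial_weight.
by move=> z _; exact: monomial_weight_ge0.
Qed.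

Lemma GammaV_ge0 (a : R) : 0 <= GammaV V a.
Proof.
apply: integral_ge0 => t _; rewrite mule_ge0 ?lee_fin ?powR_ge0//.
exact: expeR_ge0.
Qed.

(** Removing the point 0 leaves only t with t^k != 0, as [GammaV_eq0] requires. *)
Lemma GammaV_expNV (k : nat) : GammaV V (1 + k%:R) =
  \int[leb]_(t in `]0%R, +oo[%classic) radial_weight V k t.
Proof.
rewrite integral_itv_obnd_cbnd; last first.
  by apply: measurable_funTS; exact: (measurable_radial_weight V_meas).
by apply: eq_integral => t /set_mem/halflineP t0; rewrite radial_weight_gammaV.
Qed.

(* Both vanish exactly when e^(-V) = 0 almost everywhere on the half-line. *)
Lemma GammaV_eq0 (k l : nat) :
  GammaV V (1 + k%:R) = 0 -> GammaV V (1 + l%:R) = 0.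
Proof.
rewrite !GammaV_expNV => k0.
pose D : set (measurableTypeR R) := `]0%R, +oo[%classic.
have mD : measurable D by exact: measurable_itv.
have mw n : measurable_fun D (radial_weight V n).
  by apply: measurable_funTS; exact: (measurable_radial_weight V_meas).
have eq0 : ae_eq leb D (radial_weight V k) (cst 0).
  apply/(ae_eq_integral_abs leb mD (mw k)).
  rewrite -[RHS]k0; apply: eq_integral => t _.
  by rewrite gee0_abs// radial_weight_ge0.
rewrite (ae_eq_integral (cst 0))//; first exact: integral0.
apply: filterS eq0 => t /= /[swap] Dt /(_ Dt) /eqP.
have t0 : (0 < t)%R by move: Dt; rewrite /D/= in_itv/= andbT.
rewrite /radial_weight mule_eq0 eqe expf_eq0 (gt_eqF t0) andbF/=.
by move=> /eqP ->; rewrite mule0.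
Qed.

Lemma beta_mass_fin :
  (fine (beta_mass N (2 * p)%:R V))%:E = beta_mass N (2 * p)%:R V.
Proof. by rewrite fineK// gt0_fin_numE//; case/andP: V_wd. Qed.

Lemma fine_beta_mass_gt0 : (0 < fine (beta_mass N (2 * p)%:R V))%R.
Proof. by rewrite -lte_fin beta_mass_fin; case/andP: V_wd. Qed.

(** If one value were 0 they would all be; since N > 0 every term of [beta_massE] would contain a
    zero factor, against positivity of the mass. *)
Lemma GammaV_gt0 (k : nat) : 0 < GammaV V (1 + k%:R).
Proof.
rewrite lt_neqAle GammaV_ge0 andbT; apply/eqP => /esym k0.
have : 0 < beta_mass N (2 * p)%:R V by case/andP: V_wd.
rewrite beta_massE big1 ?ltxx// => m _; rewrite radial_lawT.
by rewrite (bigD1 (Ordinal hN))//= (GammaV_eq0 _ k0) mule0 mul0e mule0.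
Qed.

Lemma radial_lawT_gt0 m : 0 < law m setT.
Proof.
rewrite radial_lawT; apply: (big_ind (fun x => 0 < x)) => //.
  by move=> x y x0 y0; exact: mule_gt0.
by move=> i _; rewrite mule_gt0 ?GammaV_gt0// lte_fin pi_gt0.
Qed.

Lemma radial_lawT_lty m : m \in supp -> law m setT < +oo.
Proof.
move=> ms; have /andP[_] := V_wd.
rewrite beta_massE (bigD1_seq m)//= ?mpoly.msupp_uniq//.
apply: contraTT; rewrite -!leNgt !leye_eq => /eqP ->.
rewrite gt0_muley ?lte_fin ?sqr_coef_gt0// addye//.
rewrite -ltNye; apply: (@lt_le_trans _ _ 0) => //.
by apply: sume_ge0 => k _; rewrite mule_ge0 ?lee_fin ?sqr_coef_ge0.
Qed.

(** An infinite factor would make the whole product infinite, since the other factors are positive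
    and rule out 0 times infinity. *)
Lemma GammaV_lty m : m \in supp -> forall i, GammaV V (1 + (m i)%:R) < +oo.
Proof.
move=> ms i; have := radial_lawT_lty ms; rewrite radial_lawT.
apply: contraTT; rewrite -!leNgt !leye_eq => /eqP Gi.
rewrite (bigD1 i)//= Gi gt0_muley ?lte_fin ?pi_gt0// gt0_mulye//.
apply: (big_ind (fun x => 0 < x)) => //.
  by move=> x y x0 y0; exact: mule_gt0.
by move=> j _; rewrite mule_gt0 ?GammaV_gt0// lte_fin pi_gt0.
Qed.

Lemma radial_lawT_fin m : m \in supp -> (fine (law m setT))%:E = law m setT.
Proof. by move=> ms; rewrite fineK// ge0_fin_numE// radial_lawT_lty. Qed.

Section ensemble_law.
Context d (Omega : measurableType d) (P : probability Omega R)
  (lambda : {RV P >-> N.-tuple (plane R)}).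
Hypothesis lambda_law : is_beta_ensemble (2 * p)%:R V lambda.

Let c : R := (fine (beta_mass N (2 * p)%:R V))^-1.

Lemma beta_ZE : (pi ^+ N * beta_Z N (2 * p)%:R V)^-1%R = c.
Proof.
by rewrite /beta_Z mulrCA divff ?mulr1// expf_eq0 gt_eqF ?andbF// pi_gt0.
Qed.

(** The law is given on events only; identifying it with a [density_measure] extends it to
    integrals. *)
Lemma expectation_beta_ensemble (h : N.-tuple (plane R) -> \bar R) :
  measurable_fun setT h -> (forall z, 0 <= h z) ->
  \int[P]_w h (lambda w) = c%:E * \int[lebesgue_CN R N]_z (h z * weight z).
Proof.
move=> mh h0.
have c0 : (0 <= c)%R by rewrite invr_ge0 ltW// fine_beta_mass_gt0.
pose f z := c%:E * weight z.
have mf : measurable_fun setT f.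
  by apply: measurable_funeM; exact: measurable_beta_weight.
have f0 z : 0 <= f z by rewrite mule_ge0 ?lee_fin// beta_weight_ge0.
rewrite -(ge0_integral_distribution lambda)//.
rewrite (eq_measure_integral (density_measure (lebesgue_CN R N) mf f0)); last first.
  move=> A mA _; apply: etrans (lambda_law mA) _.
  by apply: eq_integral => z _; rewrite beta_ZE.
rewrite ge0_integral_density_measure//; last first.
  by move=> z; rewrite fin_numM// beta_weight_fin.
rewrite -ge0_integralZl//; last 2 first.
- by apply: emeasurable_funM => //; exact: measurable_beta_weight.
- by move=> z _; rewrite mule_ge0// beta_weight_ge0.
by apply: eq_integral => z _; rewrite /f muleCA.
Qed.

(** Division by 0 gives 0, so all these weights vanish where D(t) = 0. *)
Definition posterior m z : R :=
  (sqr_coef m * monomial m (sqr_radii z) / radial_average p (sqr_radii z))%R.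

Lemma posterior_ge0 m z : (0 <= posterior m z)%R.
Proof.
have t0 := sqr_radii_ge0 z; apply: divr_ge0; last exact: radial_average_ge0.
by apply: mulr_ge0; [exact: sqr_coef_ge0|exact: monomial_ge0].
Qed.

Lemma measurable_posterior m : measurable_fun setT (posterior m).
Proof.
apply: measurable_funM.
  by apply: measurable_funM => //; exact: measurable_monomial.
(* The inverse is turned into a real power, which is measurable; both are 0 at 0. *)
have inv1 z : (radial_average p (sqr_radii z))^-1%R =
    (radial_average p (sqr_radii z) `^ (-1))%R.
  by rewrite powR_inv1// radial_average_ge0// => i; exact: sqr_radii_ge0.
rewrite (funext inv1).
apply: (@measurableT_comp _ _ _ _ _ _ (@powR R ^~ (-1)%R)) => //.
exact: measurable_radial_average.
Qed.

Lemma eq_posterior m z z' : sqr_radii z =1 sqr_radii z' ->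
  posterior m z = posterior m z'.
Proof. by move=> /funext zz'; rewrite /posterior zz'. Qed.

Lemma sum_posterior z : radial_average p (sqr_radii z) != 0%R ->
  (\sum_(m <- supp) posterior m z = 1)%R.
Proof. by move=> D0; rewrite /posterior -mulr_suml divff. Qed.

(* If the denominator vanishes then so does the m-th term of this sum of
   nonnegative terms. *)
Lemma posteriorK m z : m \in supp ->
  (radial_average p (sqr_radii z) * posterior m z =
   sqr_coef m * monomial m (sqr_radii z))%R.
Proof.
move=> ms; have t0 := sqr_radii_ge0 z.
have [D0|D0] := eqVneq (radial_average p (sqr_radii z)) 0%R; last first.
  by rewrite /posterior mulrC divfK.
rewrite D0 mul0r; apply/esym/eqP; move: D0; rewrite /radial_average.
rewrite (bigD1_seq m)//= ?mpoly.msupp_uniq// => /eqP.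
rewrite paddr_eq0; first by move=> /andP[].
- by rewrite mulr_ge0 ?sqr_ge0 ?monomial_ge0.
- by apply: sumr_ge0 => k _; rewrite mulr_ge0 ?sqr_ge0 ?monomial_ge0.
Qed.

(** Bayes' rule: averaging replaces |Delta|^(2p) by D(t), which cancels the denominator of the
    posterior and leaves the [m]-th component. *)
Lemma expectation_posterior m A : m \in supp -> measurable A ->
  \int[P]_w ((\1_A (radii (lambda w)) * posterior m (lambda w))%R)%:E =
  (c * sqr_coef m)%:E * law m A.
Proof.
move=> ms mA; pose h z := ((\1_A (radii z) * posterior m z)%R)%:E.
have mi : measurable_fun setT (\1_A : N.-tuple (measurableTypeR R) -> R).
  exact: measurable_indic.
have mA' : measurable_fun setT (fun z => \1_A (radii z) : R).
  exact: (measurableT_comp mi (@measurable_radii R N)).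
have mh : measurable_fun setT h.
  apply/measurable_EFinP; apply: measurable_funM => //.
  exact: measurable_posterior.
have h0 z : 0 <= h z by rewrite lee_fin mulr_ge0// posterior_ge0.
rewrite (@expectation_beta_ensemble h)// EFinM -muleA; congr *%E.
rewrite integral_radial_beta_weight//; last first.
  by move=> z z' zz'; rewrite /h (eq_posterior _ zz') (iffLR (radiiP z z') zz').
rewrite radial_lawE// -ge0_integralZl ?lee_fin ?sqr_coef_ge0//; last 2 first.
- apply: emeasurable_funM; last exact: measurable_monomial_weight.
  exact/measurable_EFinP.
- by move=> z _; rewrite mule_ge0 ?lee_fin// monomial_weight_ge0.
apply: eq_integral => z _; rewrite /h /monomial_weight !muleA -!EFinM.
by congr (_%:E * _); rewrite mulrCA posteriorK// mulrCA mulrA.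
Qed.

(** The posterior weights sum to 1 only almost surely, hence the integrated form, which is what the
    extension by an index asks for. *)
Lemma sum_expectation_posterior E : measurable E ->
  \sum_(m <- supp) \int[P]_(w in E) (posterior m (lambda w))%:E = P E.
Proof.
move=> mE.
have mpost m : measurable_fun E (fun w => (posterior m (lambda w))%:E).
  apply/measurable_funTS/measurable_EFinP.
  exact: (measurableT_comp (measurable_posterior m) (measurable_funPT lambda)).
rewrite -ge0_integral_sum//; last by move=> m w _; rewrite lee_fin posterior_ge0.
pose Z := [set z : N.-tuple (plane R) | radial_average p (sqr_radii z) = 0%R].
have mZ : measurable Z.
  rewrite -[Z]setTI.
  exact: (@measurable_radial_average R N p measurableT _ (measurable_set1 0%R)).
have PZ : P (lambda @^-1` Z) = 0.
  have mlZ : measurable (lambda @^-1` Z) by exact: measurable_funPTI.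
  rewrite -[X in P X](setIT) -integral_indic//.
  transitivity (\int[P]_w (\1_Z (lambda w))%:E) => //.
  rewrite (@expectation_beta_ensemble (fun z => (\1_Z z)%:E)); last 2 first.
  - by apply/measurable_EFinP; exact: measurable_indic.
  - by move=> z; rewrite lee_fin.
  rewrite integral_radial_beta_weight; last 3 first.
  - by apply/measurable_EFinP; exact: measurable_indic.
  - by move=> z; rewrite lee_fin.
  - move=> z z' /funext zz'; rewrite !indicE; congr (nat_of_bool _)%:R%:E.
    by apply/idP/idP => /set_mem; rewrite /Z/= => E0; apply/mem_set;
      rewrite /Z/= -E0 zz'.
  (* After averaging, the integrand contains the indicator of the zero set of D times D itself,
     which is 0. *)
  rewrite integral0_eq ?mule0// => z _; rewrite muleA -EFinM indicE.
  have [/set_mem ->|_] := boolP (z \in Z); first by rewrite mul0r mul0e.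
  by rewrite mulr0 mul0e.
rewrite -[RHS]mul1e -integral_cst//.
apply: ge0_ae_eq_integral => //.
- by apply: emeasurable_sum => m; exact: mpost.
- by move=> w _; apply: sume_ge0 => m _; rewrite lee_fin posterior_ge0.
exists (lambda @^-1` Z); split => //.
  exact: measurable_funPTI.
move=> w /= wZ; rewrite /Z/=; apply: contra_notP wZ => /eqP D0 _.
by rewrite sumEFin sum_posterior.
Qed.

End ensemble_law.

End ensemble_radii.

(** * Extension by a latent index *)

(* Given the weights q_u, each point of the base space is split into copies
   indexed by u; a natural number codes the index since U carries no
   measurable structure. *)
Section indexed_extension.
Local Open Scope ereal_scope.
Context d (Omega : measurableType d) (R : realType) (P : probability Omega R).
Context (U : countType) (s : seq U) (q : U -> Omega -> \bar R).
Hypotheses (uniq_s : uniq s) (mq : forall u, measurable_fun setT (q u)).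
Hypotheses (q0 : forall u w, 0 <= q u w).
Hypothesis sumq : forall E, measurable E ->
  \sum_(u <- s) \int[P]_(w in E) q u w = P E.

Let copy (u : U) (w : Omega) : Omega * nat := (w, choice.pickle u).

Let mcopy u : measurable_fun setT (copy u).
Proof. exact: measurable_fun_pair. Qed.

Definition extension_measure : set (Omega * nat) -> \bar R :=
  fun G => \sum_(u <- s) \int[P]_(w in copy u @^-1` G) q u w.

Let copy_measure u G := \int[P]_(w in copy u @^-1` G) q u w.

Let copy_measure_sigma_additive u : semi_sigma_additive (copy_measure u).
Proof.
(* [copy_measure u] is the image under [copy u] of the measure with density [q u]. *)
pose c : {mfun Omega >-> (Omega * nat)%type} :=
  HB.pack (copy u) (isMeasurableFun.Build _ _ _ _ _ (mcopy u)).
pose nu := density_measure P (mq u) (q0 u).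
exact: (@measure_semi_sigma_additive _ _ _ (pushforward nu c)).
Qed.

Let extension_measure0 : extension_measure set0 = 0.
Proof.
by rewrite /extension_measure big1// => u _; rewrite preimage_set0 integral_set0.
Qed.

Let extension_measure_ge0 G : 0 <= extension_measure G.
Proof. by apply: sume_ge0 => u _; apply: integral_ge0 => w _; exact: q0. Qed.

Let extension_measure_sigma_additive : semi_sigma_additive extension_measure.
Proof.
move=> F mF tF mUF.
rewrite [X in X @ _ --> _](_ : _ = fun n =>
    \sum_(u <- s) \sum_(0 <= i < n) copy_measure u (F i)); last first.
  by apply/funext => n; rewrite exchange_big.
apply: cvg_nnesum => [u _|u _].
  near=> n; apply: sume_ge0 => i _.
  by apply: integral_ge0 => w _; exact: q0.
exact: copy_measure_sigma_additive.
Unshelve. all: by end_near. Qed.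

HB.instance Definition _ := isMeasure.Build _ _ _ extension_measure
  extension_measure0 extension_measure_ge0 extension_measure_sigma_additive.

Let extension_measureT : extension_measure setT = 1.
Proof. by rewrite -(probability_setT P) -sumq. Qed.

HB.instance Definition _ :=
  Measure_isProbability.Build _ _ _ extension_measure extension_measureT.

(** [u0] is the value of [I] at naturals that code no index; the copies sit at codes, so such points
    carry no mass. *)
Lemma indexed_extension (u0 : U) : exists (d1 : measure_display)
    (Omega1 : measurableType d1) (P1 : probability Omega1 R)
    (ext : {RV P1 >-> Omega}) (I : Omega1 -> U),
  (forall E, measurable E -> distribution P1 ext E = P E) /\
  forall u, measurable (I @^-1` [set u]) /\
    forall E, measurable E -> P1 (ext @^-1` E `&` I @^-1` [set u]) =
      if u \in s then \int[P]_(w in E) q u w else 0.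
Proof.
pose I (x : Omega * nat) := odflt u0 (choice.unpickle x.2).
pose P1 : probability (Omega * nat)%type R := extension_measure.
pose ext : {RV P1 >-> Omega} :=
  HB.pack fst (isMeasurableFun.Build _ _ _ _ _ measurable_fst).
exists _, (Omega * nat)%type, P1, ext, I; split.
  by move=> E mE; rewrite -sumq.
move=> u; split.
  rewrite (_ : _ @^-1` _ = snd @^-1` [set n | odflt u0 (choice.unpickle n) = u])//.
  by rewrite -[X in measurable X]setTI; exact: measurable_snd.
move=> E mE; rewrite -[LHS]/(extension_measure _) /extension_measure.
(* Only the copy indexed by [u] meets the fibre of [I] over [u]. *)
have copyE v : copy v @^-1` (fst @^-1` E `&` I @^-1` [set u]) =
    if v == u then E else set0.
  apply/seteqP; split => w; rewrite /copy/I/= choice.pickleK/=.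
    by move=> [Ew <-]; rewrite eqxx.
  by case: eqP => // -> Ew.
under eq_bigr do rewrite copyE.
have [us|us] := boolP (u \in s).
  rewrite (bigD1_seq u)//= eqxx big1 ?adde0// => v /negbTE ->.
  exact: integral_set0.
rewrite big1_seq// => v /= vs; rewrite ifF ?integral_set0//.
by apply: contraNF us => /eqP <-.
Qed.

End indexed_extension.

(** * The latent variable *)

Section exponents.
Context (N p : nat).
Implicit Types (m : mpoly.multinom N) (u : N.-tuple int).
Local Notation supp := (mpoly.msupp (vandermonde_poly N ^+ p)).

Definition int_of_multinom m : N.-tuple int := [tuple Posz (m i) | i < N].

(** The absolute value is as in [vandermonde_coef]; only on nonnegative tuples does this invert
    [int_of_multinom]. *)
Definition multinom_of_int u : mpoly.multinom N :=
  mpoly.Multinom [tuple `|tnth u i|%N | i < N].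

Lemma int_of_multinomK : cancel int_of_multinom multinom_of_int.
Proof.
move=> m; apply/mpoly.mnmP => i.
by rewrite mpoly.multinomE !tnth_mktuple absz_nat.
Qed.

Lemma vandermonde_coef_multinom m :
  vandermonde_coef p (int_of_multinom m) =
  mpoly.mcoeff m (vandermonde_poly N ^+ p).
Proof.
rewrite /vandermonde_coef ifT; last first.
  by apply/forallP => i; rewrite tnth_mktuple.
by rewrite -/(multinom_of_int _) int_of_multinomK.
Qed.

Lemma vandermonde_coef_neq0P u : vandermonde_coef p u != 0 ->
  exists2 m, m \in supp & u = int_of_multinom m.
Proof.
rewrite /vandermonde_coef; case: ifPn => [/forallP u0 uK|]; last by rewrite eqxx.
exists (multinom_of_int u); first by rewrite mpoly.mcoeff_msupp.
apply: eq_from_tnth => i; rewrite tnth_mktuple mpoly.multinomE tnth_mktuple.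
by rewrite gez0_abs.
Qed.

Lemma gamma_param_multinom (R : realType) m i :
  gamma_param R (int_of_multinom m) i = 1 + (m i)%:R.
Proof. by rewrite /gamma_param tnth_mktuple. Qed.

End exponents.

Section latent_variable.
Context (R : realType) (V : R -> \bar R) (N p : nat).
Hypothesis hN : (0 < N)%N.
Hypothesis V_fin : forall t : R, 0 <= t -> V t != -oo%E.
Hypothesis V_meas : measurable_fun (halfline R) V.
Hypothesis V_wd : beta_well_defined N (2 * p)%:R V.
Local Open Scope ereal_scope.
Implicit Types (m : mpoly.multinom N) (u : N.-tuple int).
Local Notation supp := (mpoly.msupp (vandermonde_poly N ^+ p)%R).
Local Notation law := (radial_law V_meas).

Let c : R := (fine (beta_mass N (2 * p)%:R V))^-1.

(** The pi^N in the total mass of [law m] cancels the one divided out in [beta_Z]. *)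
Lemma latent_weight_multinom m : m \in supp ->
  latent_weight p V (int_of_multinom m) = (c * sqr_coef R p m)%:E * law m setT.
Proof.
move=> ms; rewrite /latent_weight vandermonde_coef_multinom.
rewrite ifF; last by apply/negbTE; rewrite -mpoly.mcoeff_msupp.
rewrite radial_lawT big_split/= prodEFin prodr_const card_ord muleA -EFinM.
congr (_%:E * _); last first.
  by apply: eq_bigr => i _; rewrite gamma_param_multinom.
by rewrite /beta_Z invf_div /c /sqr_coef; ring.
Qed.

Lemma latent_weight_gt0P u : 0 < latent_weight p V u ->
  exists2 m, m \in supp & u = int_of_multinom m.
Proof.
rewrite /latent_weight; case: eqP => [_|/eqP uK _]; first by rewrite ltxx.
exact: vandermonde_coef_neq0P.
Qed.

Lemma latent_weight_multinom_gt0 m : m \in supp ->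
  0 < latent_weight p V (int_of_multinom m).
Proof.
move=> ms; rewrite latent_weight_multinom// mule_gt0 ?(radial_lawT_gt0 hN _ V_wd)//.
by rewrite lte_fin mulr_gt0 ?sqr_coef_gt0// invr_gt0 (fine_beta_mass_gt0 V_wd).
Qed.

Lemma latent_weight_ge0 u : 0 <= latent_weight p V u.
Proof.
have [uK|uK] := eqVneq (vandermonde_coef p u) 0%R.
  by rewrite /latent_weight uK eqxx.
have [m ms ->] := vandermonde_coef_neq0P uK.
exact/ltW/latent_weight_multinom_gt0.
Qed.

Lemma sum_latent_weight_multinom :
  \sum_(m <- supp) latent_weight p V (int_of_multinom m) = 1.
Proof.
rewrite (eq_big_seq (fun m => c%:E * ((sqr_coef R p m)%:E * law m setT))).
  rewrite -ge0_sume_distrr.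
    rewrite -(beta_massE N p V_meas) -(beta_mass_fin V_wd) -EFinM mulVf//.
    by rewrite gt_eqF// (fine_beta_mass_gt0 V_wd).
  by move=> m _; rewrite mule_ge0 ?lee_fin ?sqr_coef_ge0.
by move=> m ms; rewrite latent_weight_multinom// EFinM muleA.
Qed.

Definition latent_support : seq (N.-tuple int) := map (@int_of_multinom N) supp.

Lemma latent_support_uniq : uniq latent_support.
Proof.
rewrite map_inj_uniq ?mpoly.msupp_uniq//.
exact: can_inj (@int_of_multinomK N).
Qed.

Lemma latent_weight_notin u :
  u \notin latent_support -> latent_weight p V u = 0.
Proof.
have [uK _|uK] := eqVneq (vandermonde_coef p u) 0%R.
  by rewrite /latent_weight uK eqxx.
by have [m ms ->] := vandermonde_coef_neq0P uK; rewrite map_f.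
Qed.

Lemma esum_latent_weight : \esum_(u in [set: N.-tuple int]) latent_weight p V u = 1.
Proof.
rewrite -sum_latent_weight_multinom -(big_map _ xpredT) -/latent_support.
rewrite fsbig_seq ?latent_support_uniq// -esum_fset//; last first.
  by move=> u _; exact: latent_weight_ge0.
rewrite [RHS]esum_mkcond; apply: eq_esum => u _.
have [//|/negP us] := boolP (u \in [set` latent_support]).
by rewrite latent_weight_notin//; apply/negP => us'; apply: us; rewrite inE.
Qed.

(** Independence over the full index set fixes the joint law on rectangles, and these determine it.
    [Q] is any measure so that conditional probabilities are covered. *)
Lemma indep_GammaV_law m d (Omega : measurableType d)
    (Q : {measure set Omega -> \bar R}) (X : 'I_N -> Omega -> measurableTypeR R) :
  m \in supp -> (forall i, measurable_fun setT (X i)) ->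
  indep_GammaV V Q X (int_of_multinom m) ->
  forall A : set (N.-tuple (measurableTypeR R)), measurable A ->
  Q [set w | A [tuple X i w | i < N]] = ((fine (law m setT))^-1)%:E * law m A.
Proof.
move=> ms mX [indX lawX] A mA.
have k0 : (0 <= (fine (law m setT))^-1)%R by rewrite invr_ge0 fine_ge0.
pose Xt w : N.-tuple (measurableTypeR R) := [tuple X i w | i < N].
have mXt : measurable_fun setT Xt.
  apply/measurable_fun_tnthP => i; rewrite (_ : _ \o _ = X i)//.
  by apply/funext => w /=; rewrite tnth_mktuple.
pose Xt' : {mfun Omega >-> N.-tuple (measurableTypeR R)} :=
  HB.pack Xt (isMeasurableFun.Build _ _ _ _ _ mXt).
suff : mscale (NngNum k0) (law m) A = pushforward Q Xt' A by [].
apply: (@tuple_measure_unique _ _ _ _ (mscale (NngNum k0) (law m))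
  (pushforward Q Xt')) => //.
  rewrite /= /mscale/= -(radial_lawT_fin _ V_wd)//.
  by rewrite -EFinM ltry.
move=> B mB; rewrite /= /mscale/= /pushforward.
rewrite (_ : _ @^-1` _ =
    \bigcap_(i in [set` [set: 'I_N]%SET]) X i @^-1` B i); last first.
  apply/seteqP; split => w /=.
    by move=> XB i _; have := XB i; rewrite tnth_mktuple.
  by move=> XB i; rewrite tnth_mktuple; apply: XB; rewrite /= inE.
rewrite indX// radial_law_rectangle//.
have GE i : (fine (GammaV V (1 + (m i)%:R)))%:E = GammaV V (1 + (m i)%:R).
  by rewrite fineK// ge0_fin_numE ?GammaV_ge0// (GammaV_lty hN V_meas V_wd ms).
have G0 i : (0 < fine (GammaV V (1 + (m i)%:R)))%R.
  by rewrite -lte_fin GE (GammaV_gt0 hN V_meas V_wd).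
(* The normalising factor splits over the coordinates, each piece normalising one Gamma_V law. *)
have -> : ((fine (law m setT))^-1)%R =
    (\prod_(i < N) (pi * fine (GammaV V (1 + (m i)%:R)))^-1)%R.
  rewrite prodfV; congr (_^-1)%R; apply: EFin_inj.
  rewrite (radial_lawT_fin _ V_wd)// radial_lawT -prodEFin.
  by apply: eq_bigr => i _; rewrite EFinM GE.
rewrite -prodEFin -big_split/=; apply: eq_big => [i|i _]; first by rewrite inE.
have [_ lawXi] := lawX i; rewrite lawXi// gamma_param_multinom.
rewrite muleA -EFinM invfM mulrAC mulVf ?gt_eqF ?pi_gt0// mul1r.
have mBi : measurable (B i `&` halfline R).
  by apply: measurableI => //; exact: measurable_itv.
rewrite ge0_integralZl//.
- apply: (eq_measurable_fun (radial_weight V (m i))).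
    by move=> t /set_mem[_ /halflineP t0]; rewrite radial_weight_gammaV.
  by apply: measurable_funTS; exact: (measurable_radial_weight V_meas).
- move=> t _; rewrite mule_ge0 ?lee_fin ?powR_ge0//; exact: expeR_ge0.
- by rewrite lee_fin invr_ge0 ltW.
Qed.

(** [cond_prob] is convertible to a scaled restriction of [Q], which is a measure. *)
Lemma cond_GammaV_law m d (Omega : measurableType d) (Q : probability Omega R)
    (E : set Omega) (X : 'I_N -> Omega -> measurableTypeR R) :
  m \in supp -> (forall i, measurable_fun setT (X i)) -> measurable E ->
  indep_GammaV V (cond_prob Q E) X (int_of_multinom m) ->
  forall A : set (N.-tuple (measurableTypeR R)), measurable A ->
  cond_prob Q E [set w | A [tuple X i w | i < N]] =
    ((fine (law m setT))^-1)%:E * law m A.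
Proof.
move=> ms mX mE indX A mA.
have k0 : (0 <= (fine (Q E))^-1)%R by rewrite invr_ge0 fine_ge0.
exact: (@indep_GammaV_law m _ _ (mscale (NngNum k0) (mrestr Q mE)) X).
Qed.

Lemma integral_posterior d (Omega : measurableType d) (P : probability Omega R)
    (lambda : {RV P >-> N.-tuple (plane R)}) m A :
  is_beta_ensemble (2 * p)%:R V lambda -> m \in supp -> measurable A ->
  \int[P]_(w in [set w | A (radii (lambda w))]) (posterior p m (lambda w))%:E =
  (c * sqr_coef R p m)%:E * law m A.
Proof.
move=> lambda_law ms mA.
rewrite -(expectation_posterior V_fin V_meas V_wd lambda_law ms mA).
rewrite integral_mkcond; apply: eq_integral => w _.
by rewrite epatch_indic/= muleC -EFinM !indicE.
Qed.

End latent_variable.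

Theorem theorem3p19 (R : realType) (N p : nat) (hN : (1 <= N)%N) (hp : (1 <= p)%N)
    (V : R -> \bar R)
    (V_fin : forall t : R, 0 <= t -> V t != -oo%E)
    (V_meas : measurable_fun (halfline R) V)
    (V_wd : beta_well_defined N (2 * p)%:R V)
    (d : measure_display) (Omega : measurableType d) (P : probability Omega R)
    (lambda : {RV P >-> N.-tuple (plane R)})
    (lambda_law : is_beta_ensemble (2 * p)%:R V lambda) :
  [/\ (* the latent variable has a probability distribution, and the laws of
         the X_i are defined *)
      (\esum_(u in [set: N.-tuple int]) latent_weight p V u = 1)%E
      /\ (forall u : N.-tuple int, vandermonde_coef p u != 0 ->
            forall i : 'I_N, (0 < GammaV V (gamma_param R u i) < +oo)%E),
      (* there is a latent variable I, defined on an extension of Omega, given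
         which the squared radii are distributed as independent X_i *)
      exists (d1 : measure_display) (Omega1 : measurableType d1)
             (P1 : probability Omega1 R) (ext : {RV P1 >-> Omega})
             (I : Omega1 -> N.-tuple int),
        [/\ (forall E : set Omega, measurable E -> distribution P1 ext E = P E),
            has_latent_law p V P1 I
          & forall u : N.-tuple int, (0 < latent_weight p V u)%E ->
            forall (d2 : measure_display) (Omega2 : measurableType d2)
                   (P2 : probability Omega2 R)
                   (X : 'I_N -> {RV P2 >-> measurableTypeR R}),
              indep_GammaV V P2 X u ->
              forall A : set {mset R}%mset, unordered_event N A ->
                cond_prob P1 (I @^-1` [set u])
                  [set w | A (unordered (sqr_radii (lambda (ext w))))]
                = P2 [set w | A (unordered (fun i => X i w))]]
    & (* unconditional law of the squared radii *)
      forall (d2 : measure_display) (Omega2 : measurableType d2)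
             (P2 : probability Omega2 R) (I : Omega2 -> N.-tuple int)
             (X : 'I_N -> {RV P2 >-> measurableTypeR R}),
        two_stage_sample p V I X ->
        forall A : set {mset R}%mset, unordered_event N A ->
          P [set w | A (unordered (sqr_radii (lambda w)))]
          = P2 [set w | A (unordered (fun i => X i w))]].
Proof.
pose supp := mpoly.msupp (vandermonde_poly N ^+ p).
have c_gt0 m : m \in supp ->
    0 < (fine (beta_mass N (2 * p)%:R V))^-1 * sqr_coef R p m.
  move=> ms; rewrite mulr_gt0 ?sqr_coef_gt0//.
  by rewrite invr_gt0 (fine_beta_mass_gt0 V_wd).
have munordered A : unordered_event N A ->
    measurable [set x : N.-tuple (measurableTypeR R) | A (seq_mset x)] by [].
have mevent (B : set (N.-tuple (measurableTypeR R))) : measurable B ->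
    measurable [set w | B (radii (lambda w))].
  move=> mB; rewrite -[X in measurable X]setTI.
  exact: (measurableT_comp (@measurable_radii R N) (measurable_funPT lambda)).
split.
- split; first exact: (esum_latent_weight hN V_meas V_wd).
  move=> u uK i; have [m ms ->] := vandermonde_coef_neq0P uK.
  rewrite gamma_param_multinom (GammaV_gt0 hN V_meas V_wd).
  by rewrite (GammaV_lty hN V_meas V_wd ms).
- pose q (u : N.-tuple int) w := (posterior p (multinom_of_int u) (lambda w))%:E.
  have mq u : measurable_fun setT (q u).
    apply/measurable_EFinP.
    exact: (measurableT_comp (@measurable_posterior R N p (multinom_of_int u))
      (measurable_funPT lambda)).
  have q0 u w : (0 <= q u w)%E by rewrite lee_fin posterior_ge0.
  have sumq E : measurable E ->
      (\sum_(u <- latent_support N p) \int[P]_(w in E) q u w)%E = P E.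
    move=> mE; rewrite big_map.
    rewrite -[RHS](sum_expectation_posterior V_fin V_meas V_wd lambda_law mE).
    by apply: eq_bigr => m _; rewrite /q int_of_multinomK.
  have [d1 [ Omega1 [P1 [ext [I [extE IE]]]]]] :=
    indexed_extension (latent_support_uniq N p) mq q0 sumq
      [tuple of nseq N (0 : int)].
  (* Joint law of the index and the squared radii: its [m]-marginal gives the latent weights, and
     their quotient the conditional law. *)
  have PI m (B : set (N.-tuple (measurableTypeR R))) : m \in supp ->
      measurable B ->
      P1 ([set w | B (radii (lambda (ext w)))] `&`
        I @^-1` [set int_of_multinom m]) =
      (((fine (beta_mass N (2 * p)%:R V))^-1 * sqr_coef R p m)%:E *
        radial_law V_meas m B)%E.
    move=> ms mB; have [_ /(_ _ (mevent B mB))] := IE (int_of_multinom m).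
    rewrite map_f// /q int_of_multinomK => PE; apply: etrans PE _.
    exact: (integral_posterior V_fin V_meas V_wd lambda_law ms mB).
  have PIu u : P1 (I @^-1` [set u]) = latent_weight p V u.
    have [us|us] := boolP (u \in latent_support N p).
      have /mapP[m ms ->] := us.
      rewrite (latent_weight_multinom V_meas ms) -PI//.
      by congr (P1 _); apply/seteqP; split => // w [].
    rewrite latent_weight_notin//.
    have [_ /(_ setT measurableT)] := IE u; rewrite (negbTE us).
    by rewrite preimage_setT setTI.
  exists d1, Omega1, P1, ext, I; split => //.
    by move=> u; split; [case: (IE u)|exact: PIu].
  move=> u u0 d2 Omega2 P2 X indX A /munordered mA.
  have [m ms um] := latent_weight_gt0P u0; rewrite um in indX u0 *.
  (* Both sides are the normalised component [radial_law V_meas m]. *)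
  have X_law := indep_GammaV_law hN V_meas V_wd ms
    (fun i => measurable_funPT (X i)) indX mA.
  apply: etrans (esym X_law).
  rewrite /cond_prob PIu (latent_weight_multinom V_meas ms).
  rewrite -[X in fine (_ * X)](radial_lawT_fin V_meas V_wd ms) -EFinM/=.
  have -> := PI m _ ms mA; rewrite muleA -EFinM; congr (_%:E * _)%E.
  by rewrite invfM mulrAC mulVf ?mul1r// gt_eqF// c_gt0.
- move=> d2 Omega2 P2 I X [Ilaw indX] A /munordered mA.
  pose F u := [set w | A (unordered (fun i => X i w))] `&` I @^-1` [set u].
  have mX : measurable [set w | A (unordered (fun i => X i w))].
    have mXt : measurable_fun setT
        (fun w => [tuple X i w | i < N] : N.-tuple (measurableTypeR R)).
      apply/measurable_fun_tnthP => i; rewrite (_ : _ \o _ = X i)//.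
      by apply/funext => w /=; rewrite tnth_mktuple.
    by rewrite -[X in measurable X]setTI; exact: (mXt measurableT _ mA).
  have mI u : measurable (I @^-1` [set u]) by case: (Ilaw u).
  have PI u : P2 (I @^-1` [set u]) = latent_weight p V u by case: (Ilaw u).
  have PF m : m \in supp -> P2 (F (int_of_multinom m)) =
      (((fine (beta_mass N (2 * p)%:R V))^-1 * sqr_coef R p m)%:E *
        radial_law V_meas m [set x | A (seq_mset x)])%E.
    move=> ms; have u0 := latent_weight_multinom_gt0 hN V_meas V_wd ms.
    have := cond_GammaV_law hN V_meas V_wd ms
      (fun i => measurable_funPT (X i)) (mI _) (indX _ u0) mA.
    rewrite /cond_prob PI (latent_weight_multinom V_meas ms).
    set a := _ * sqr_coef R p m.
    have l0 : 0 < fine (radial_law V_meas m setT).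
      rewrite -lte_fin (radial_lawT_fin V_meas V_wd ms).
      exact: (radial_lawT_gt0 hN _ V_wd).
    rewrite -[X in fine (_ * X)](radial_lawT_fin V_meas V_wd ms) -EFinM/=.
    set l := fine _ in l0 *; have al0 : a * l != 0.
      by rewrite mulf_neq0// gt_eqF// c_gt0.
    (* Multiplying by P2(I = u) = a l, which is nonzero, undoes the conditioning. *)
    move=> /(congr1 (fun x => (a * l)%:E * x)%E).
    rewrite !muleA -!EFinM mulfV// mul1e => ->.
    by rewrite mulfK// gt_eqF.
  pose D := [set` latent_support N p].
  have trivI G : trivIset D (fun u => G `&` I @^-1` [set u]).
    by move=> u v _ _ [w [[_ <-] [_ <-]]].
  have finD : finite_set D by exact: finite_seq.
  have sumD (G : set Omega2) : measurable G ->
      P2 (G `&` \bigcup_(u in D) I @^-1` [set u]) =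
      (\sum_(m <- supp) P2 (G `&` I @^-1` [set int_of_multinom m]))%E.
    move=> mG; rewrite setI_bigcupr measure_fin_bigcup//; last first.
      by move=> u _; exact: measurableI.
    by rewrite -fsbig_seq ?latent_support_uniq// big_map.
  (* The latent weights on the finite set [D] already sum to 1, so [I] lies in [D] almost surely and
     a finite sum gives total probability. *)
  have PD : P2 (\bigcup_(u in D) I @^-1` [set u]) = 1%E.
    rewrite -[X in P2 X]setTI sumD// -(sum_latent_weight_multinom V_meas V_wd).
    by apply: eq_bigr => m _; rewrite setTI PI.
  have mD : measurable (\bigcup_(u in D) I @^-1` [set u]).
    by apply: fin_bigcup_measurable => // u _; exact: mI.
  have PDC : P2 (~` \bigcup_(u in D) I @^-1` [set u]) = 0%E.
    by rewrite probability_setC// PD subee.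
  rewrite (measureDI P2 mX mD) setDE.
  rewrite [X in (X + _)%E](_ : _ = 0%E) ?add0e; last first.
    apply/eqP; rewrite eq_le measure_ge0 andbT -PDC; apply: le_measure.
    - by rewrite inE; apply: measurableI => //; exact: measurableC.
    - by rewrite inE; exact: measurableC.
    - by move=> w [].
  apply: etrans (esym (sumD _ mX)).
  rewrite -(sum_expectation_posterior V_fin V_meas V_wd lambda_law
    (mevent _ mA)).
  (* Posterior weights split the left side as [I] splits the right side; the two [m]-th terms are
     the same multiple of [radial_law V_meas m]. *)
  apply: eq_big_seq => m ms; rewrite -/(F _) PF//.
  exact: (integral_posterior V_fin V_meas V_wd lambda_law ms mA).
Qed.
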